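(* Let $2<m<\omega$ and let $n$ be finite with $n\ge m+2$. Then the class of $\mathsf{CA}_m$'s having $n$-flat representations is not finitely axiomatizable over the class of $\mathsf{CA}_m$'s having $n$-square representations; that is, there is no finite set $\Sigma$ of first-order sentences such that an algebra with an $n$-square representation has an $n$-flat representation if and only if it satisfies $\Sigma$.
   Context: $\mathsf{CA}_m$ is the class of cylindric algebras of dimension $m$. A relativized representation of $\mathfrak A\in\mathsf{CA}_m$ is a set $M$, a set $V\subseteq{}^mM$ with $\bigcup_{s\in V}\mathrm{rng}(s)=M$, and an injective homomorphism $f$ from $\mathfrak A$ into the set algebra on $\wp(V)$ with operations relativized to $V$ ($\mathsf c_iX=\{s\in V:\exists t\in X,\ t(j)=s(j)\ \forall j\ne i\}$, $\mathsf d_{ij}=\{s\in V:s_i=s_j\}$). Write $M\models a(s)$ for $s\in f(a)$. An $m$-clique is $C\subseteq M$ with $(a_0,\dots,a_{m-1})\in V$ for all $a_0,\dots,a_{m-1}\in C$; $\mathsf C^n(M)=\{s\in{}^nM: \mathrm{rng}(s)\text{ is an } m\text{-clique}\}$. $M$ is $n$-square if for all $\bar s\in\mathsf C^n(M)$, $a\in\mathfrak A$, $i<m$, and injective $l:m\to n$: if $M\models\mathsf c_ia(s_{l(0)},\dots,s_{l(m-1)})$ then there is $\bar t\in\mathsf C^n(M)$ agreeing with $\bar s$ except possibly at $l(i)$ with $M\models a(t_{l(0)},\dots,t_{l(m-1)})$. Let $\mathcal L(\mathfrak A)^n$ be first-order logic with variables $x_0,\dots,x_{n-1}$ and an $m$-ary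 relation symbol for each element of $\mathfrak A$. Clique-guarded semantics $\models_c$ on $\bar s\in{}^nM$: atomic $a(x_{i_0},\dots,x_{i_{m-1}})$ holds iff $M\models a(s_{i_0},\dots,s_{i_{m-1}})$; Boolean connectives as usual; $M,\bar s\models_c\exists x_i\varphi$ iff some $\bar t\in\mathsf C^n(M)$ agreeing with $\bar s$ off $i$ has $M,\bar t\models_c\varphi$. $M$ is $n$-flat if it is $n$-square and for all $\varphi\in\mathcal L(\mathfrak A)^n$, all $\bar s\in\mathsf C^n(M)$ and all distinct $i,j<n$, $M,\bar s\models_c\exists x_i\exists x_j\varphi\leftrightarrow\exists x_j\exists x_i\varphi$. *)

(* Defs.v *)
From mathcomp Require Import all_boot.
Set Implicit Arguments.
Unset Strict Implicit.
Unset Printing Implicit Defensive.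

Record CA (m : nat) := MkCA {
  car :> Type;
  ca_add : car -> car -> car;
  ca_mul : car -> car -> car;
  ca_compl : car -> car;
  ca_zero : car;
  ca_one : car;
  ca_c : 'I_m -> car -> car;
  ca_d : 'I_m -> 'I_m -> car;
  ca_addC : forall x y, ca_add x y = ca_add y x;
  ca_mulC : forall x y, ca_mul x y = ca_mul y x;
  ca_addA : forall x y z, ca_add x (ca_add y z) = ca_add (ca_add x y) z;
  ca_mulA : forall x y z, ca_mul x (ca_mul y z) = ca_mul (ca_mul x y) z;
  ca_absorb1 : forall x y, ca_add x (ca_mul x y) = x;
  ca_absorb2 : forall x y, ca_mul x (ca_add x y) = x;
  ca_distr : forall x y z, ca_mul x (ca_add y z) = ca_add (ca_mul x y) (ca_mul x z);
  ca_compl1 : forall x, ca_add x (ca_compl x) = ca_one;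
  ca_compl0 : forall x, ca_mul x (ca_compl x) = ca_zero;
  ca_C1 : forall i, ca_c i ca_zero = ca_zero;
  ca_C2 : forall i x, ca_add x (ca_c i x) = ca_c i x;
  ca_C3 : forall i x y, ca_c i (ca_mul x (ca_c i y)) = ca_mul (ca_c i x) (ca_c i y);
  ca_C4 : forall i j x, ca_c i (ca_c j x) = ca_c j (ca_c i x);
  ca_C5 : forall i, ca_d i i = ca_one;
  ca_C6 : forall i j k, k != i -> k != j ->
            ca_d i j = ca_c k (ca_mul (ca_d i k) (ca_d k j));
  ca_C7 : forall i j x, i != j ->
            ca_mul (ca_c i (ca_mul (ca_d i j) x))
                   (ca_c i (ca_mul (ca_d i j) (ca_compl x))) = ca_zero
}.

Inductive caterm (m : nat) : Type :=
| TVar of nat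
| TZero | TOne
| TAdd of caterm m & caterm m
| TMul of caterm m & caterm m
| TCompl of caterm m
| TCyl of 'I_m & caterm m
| TDiag of 'I_m & 'I_m.

Inductive caform (m : nat) : Type :=
| FEq of caterm m & caterm m
| FNeg of caform m
| FAnd of caform m & caform m
| FEx of nat & caform m.

Fixpoint term_has_var m (k : nat) (t : caterm m) : bool :=
  match t with
  | TVar j => j == k
  | TZero | TOne | TDiag _ _ => false
  | TAdd a b | TMul a b => term_has_var k a || term_has_var k b
  | TCompl a | TCyl _ a => term_has_var k a
  end.

Fixpoint free_in m (k : nat) (f : caform m) : bool :=
  match f with
  | FEq a b => term_has_var k a || term_has_var k b
  | FNeg g => free_in k g
  | FAnd g h => free_in k g || free_in k h
  | FEx j g => (j != k) && free_in k g
  end.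

Definition is_sentence m (f : caform m) : Prop := forall k, ~~ free_in k f.

Fixpoint term_eval m (A : CA m) (e : nat -> A) (t : caterm m) : A :=
  match t with
  | TVar k => e k
  | TZero => ca_zero A
  | TOne => ca_one A
  | TAdd a b => ca_add (term_eval e a) (term_eval e b)
  | TMul a b => ca_mul (term_eval e a) (term_eval e b)
  | TCompl a => ca_compl (term_eval e a)
  | TCyl i a => ca_c i (term_eval e a)
  | TDiag i j => ca_d A i j
  end.

Definition upd (T : Type) (e : nat -> T) (k : nat) (x : T) : nat -> T :=
  fun j => if j == k then x else e j.

Fixpoint holds m (A : CA m) (e : nat -> A) (f : caform m) : Prop :=
  match f with
  | FEq a b => term_eval e a = term_eval e b
  | FNeg g => ~ holds e g
  | FAnd g h => holds e g /\ holds e h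
  | FEx k g => exists x : A, holds (upd e k x) g
  end.

(* A |= sigma (for sentences the assignment is irrelevant). *)
Definition models m (A : CA m) (f : caform m) : Prop :=
  forall e : nat -> A, holds e f.

Section Rep.
Variables (m : nat) (A : CA m).

Definition rel_c (M : Type) (V : ('I_m -> M) -> Prop) (i : 'I_m)
  (X : ('I_m -> M) -> Prop) : ('I_m -> M) -> Prop :=
  fun s => V s /\ exists t, X t /\ forall j, j != i -> t j = s j.

Definition rel_d (M : Type) (V : ('I_m -> M) -> Prop) (i j : 'I_m) :
  ('I_m -> M) -> Prop := fun s => V s /\ s i = s j.

Definition is_rel_rep (M : Type) (V : ('I_m -> M) -> Prop)
  (f : A -> ('I_m -> M) -> Prop) : Prop :=
  (forall x : M, exists s, V s /\ exists k, s k = x) /\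
  (forall a s, f a s -> V s) /\
  (forall a b s, f (ca_add a b) s <-> f a s \/ f b s) /\
  (forall a b s, f (ca_mul a b) s <-> f a s /\ f b s) /\
  (forall a s, f (ca_compl a) s <-> V s /\ ~ f a s) /\
  (forall s, ~ f (ca_zero A) s) /\
  (forall s, f (ca_one A) s <-> V s) /\
  (forall i a s, f (ca_c i a) s <-> rel_c V i (f a) s) /\
  (forall i j s, f (ca_d A i j) s <-> rel_d V i j s) /\
  (forall a b, (forall s, f a s <-> f b s) -> a = b).

(* C^n(M): n-tuples whose range is an m-clique *)
Definition clique_tuple (M : Type) (V : ('I_m -> M) -> Prop) (n : nat)
  (s : 'I_n -> M) : Prop :=
  forall g : 'I_m -> 'I_n, V (fun k => s (g k)).

Definition n_square (n : nat) (M : Type) (V : ('I_m -> M) -> Prop)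
  (f : A -> ('I_m -> M) -> Prop) : Prop :=
  forall (s : 'I_n -> M) (a : A) (i : 'I_m) (l : 'I_m -> 'I_n),
    clique_tuple V s -> injective l ->
    f (ca_c i a) (fun k => s (l k)) ->
    exists t : 'I_n -> M, clique_tuple V t /\
      (forall j, j != l i -> t j = s j) /\ f a (fun k => t (l k)).

Inductive nform (n : nat) : Type :=
| NAtom of A & ('I_m -> 'I_n)   (* a(x_{idx 0}, ..., x_{idx (m-1)}) *)
| NEq of 'I_n & 'I_n
| NNeg of nform n
| NAnd of nform n & nform n
| NEx of 'I_n & nform n.

Fixpoint csat (n : nat) (M : Type) (V : ('I_m -> M) -> Prop)
  (f : A -> ('I_m -> M) -> Prop) (s : 'I_n -> M) (phi : nform n) : Prop :=
  match phi with
  | NAtom a idx => f a (fun k => s (idx k))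
  | NEq i j => s i = s j
  | NNeg g => ~ csat V f s g
  | NAnd g h => csat V f s g /\ csat V f s h
  | NEx i g => exists t : 'I_n -> M, clique_tuple V t /\
                 (forall j, j != i -> t j = s j) /\ csat V f t g
  end.

Definition n_flat (n : nat) (M : Type) (V : ('I_m -> M) -> Prop)
  (f : A -> ('I_m -> M) -> Prop) : Prop :=
  n_square n V f /\
  forall (phi : nform n) (s : 'I_n -> M) (i j : 'I_n),
    clique_tuple V s -> i != j ->
    (csat V f s (NEx i (NEx j phi)) <-> csat V f s (NEx j (NEx i phi))).

Definition has_n_square_rep (n : nat) : Prop :=
  exists (M : Type) (V : ('I_m -> M) -> Prop) (f : A -> ('I_m -> M) -> Prop),
    is_rel_rep V f /\ n_square n V f.

Definition has_n_flat_rep (n : nat) : Prop :=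
  exists (M : Type) (V : ('I_m -> M) -> Prop) (f : A -> ('I_m -> M) -> Prop),
    is_rel_rep V f /\ n_flat n V f.

End Rep.

(* Main.v *)
(* Consider edge-coloured structures whose points are of [m + 1] sorts: [W] (here
   [None]) and [K_j] for [j < m] (here [Some j]). An edge carries a colour and an
   index below [m]: the colour matters between [W] and some [K_j], the index
   between two points of [W]. The only constraint is that two points of [W] joined
   by an edge of index [j] have non-conflicting colours towards every point of
   [K_j]. For [j != 0] colours conflict when they are distinct and nonzero; for
   [j = 0] they conflict when they belong to the same one of finitely many
   classes. The algebra at stage [r], where the number of classes is about [4 ^ r],
   is the complex algebra of the [m]-types of these structures.

   It has an [n]-square representation: a new point is specified over [m - 1]
   points only, so some index [j] is not the sort of any of them and is safe for
   the remaining edges to [W], while the remaining colours are chosen fresh. It has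
   no [n]-flat one: take [K] with one point of each sort, and for every [i] a point
   [w_i] of [W] with colour [i + 1] towards all points of [K] but the one in [K_0].
   Two of them, [w_i] and [w_i'], have colours of the same class towards the latter.
   As [n >= m + 2], flatness amalgamates them over [K], and then no index is
   possible for the edge between them.

   The ultraproduct of the stages is representable, which contradicts a finite
   axiomatization by the theorem of Los. It has as many colour classes as colours,
   so in a structure built freely, each point being created over [m - 1] others, the
   colour of an edge to [K_0] that was not prescribed can be made to depend
   injectively on the labels of the point of [W]. *)
Require Import Defs.
From mathcomp Require Import all_boot.
From mathcomp Require Import boolp classical_sets filter.
Set Implicit Arguments.
Unset Strict Implicit.
Unset Printing Implicit Defensive.

(** * Complex algebras and set algebras *)

Lemma pred_eqP (T : Type) (P Q : T -> Prop) : (forall x, P x <-> Q x) -> P = Q.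
Proof. by move=> PQ; apply: funext => x; apply: propext. Qed.

Section ComplexAlgebra.
Variables (m : nat) (T : Type).
Variables (R : 'I_m -> T -> T -> Prop) (Dg : 'I_m -> 'I_m -> T -> Prop).
Hypothesis R_refl : forall i x, R i x x.
Hypothesis R_sym : forall i x y, R i x y -> R i y x.
Hypothesis R_trans : forall i x y z, R i x y -> R i y z -> R i x z.
Hypothesis R_comm : forall i j x y z,
  R i x y -> R j y z -> exists y', R j x y' /\ R i y' z.
Hypothesis Dg_refl : forall i x, Dg i i x.
Hypothesis Dg_cyl : forall i j k x, k != i -> k != j ->
  Dg i j x <-> exists y, R k x y /\ Dg i k y /\ Dg k j y.
Hypothesis Dg_uniq : forall i j x y, i != j ->
  R i x y -> Dg i j x -> Dg i j y -> x = y.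

(** The hypotheses are the frame conditions of the axioms: that each [R i] is an equivalence
    relation gives C2 and C3, [R_comm] gives C4, [Dg_cyl] gives C6 and [Dg_uniq] gives C7. *)
Definition complex_algebra : CA m.
Proof.
refine (@MkCA m (T -> Prop)
  (fun X Y x => X x \/ Y x) (fun X Y x => X x /\ Y x) (fun X x => ~ X x)
  (fun _ => False) (fun _ => True)
  (fun i X x => exists y, R i x y /\ X y) (fun i j x => Dg i j x)
  _ _ _ _ _ _ _ _ _ _ _ _ _ _ _ _); rewrite /=.
all: try by move=> *; apply: pred_eqP => z; tauto.
- by move=> X; apply: pred_eqP => z; split=> // _; apply: EM.
- by move=> i; apply: pred_eqP => z; split=> // -[y []].
- move=> i X; apply: pred_eqP => z; split=> [[Xz|//]|]; last by right.
  by exists z.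
- move=> i X Y; apply: pred_eqP => z; split.
    move=> [y [Rzy [Xy [w [Ryw Yw]]]]]; split; first by exists y.
    by exists w; split=> //; apply: R_trans Ryw.
  move=> [[y [Rzy Xy]] [w [Rzw Yw]]]; exists y; do 2!split=> //.
  by exists w; split=> //; apply: R_trans Rzw; apply: R_sym.
- by move=> i j X; apply: pred_eqP => z; split;
    move=> [y [Rzy [w [Ryw Xw]]]]; have [y' [? ?]] := R_comm Rzy Ryw;
    exists y'; split=> //; exists w.
- by move=> i; apply: pred_eqP => z; split=> // _; apply: Dg_refl.
- by move=> i j k ki kj; apply: pred_eqP => z; apply: Dg_cyl.
- move=> i j X ij; apply: pred_eqP => z; split=> //.
  move=> [[y [Rzy [Dy Xy]]] [w [Rzw [Dw nXw]]]]; apply: nXw.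
  rewrite -(Dg_uniq ij _ Dy Dw) //; apply: R_trans Rzw; exact: R_sym.
Defined.

End ComplexAlgebra.

Section SubAlgebra.
Variables (m : nat) (A : CA m) (S : A -> Prop).
Hypothesis S_add : forall x y, S x -> S y -> S (ca_add x y).
Hypothesis S_mul : forall x y, S x -> S y -> S (ca_mul x y).
Hypothesis S_compl : forall x, S x -> S (ca_compl x).
Hypothesis S_zero : S (ca_zero A).
Hypothesis S_one : S (ca_one A).
Hypothesis S_c : forall i x, S x -> S (ca_c i x).
Hypothesis S_d : forall i j, S (ca_d A i j).

Lemma sub_eqP (x y : {x : A | S x}) : sval x = sval y -> x = y.
Proof. by case: x y => [x Sx] [y Sy] /= xy; apply: eq_exist. Qed.

Definition sub_algebra : CA m.
Proof.
refine (@MkCA m {x : A | S x}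
  (fun x y => exist S _ (S_add (svalP x) (svalP y)))
  (fun x y => exist S _ (S_mul (svalP x) (svalP y)))
  (fun x => exist S _ (S_compl (svalP x)))
  (exist S _ S_zero) (exist S _ S_one)
  (fun i x => exist S _ (S_c i (svalP x)))
  (fun i j => exist S _ (S_d i j))
  _ _ _ _ _ _ _ _ _ _ _ _ _ _ _ _).
- by move=> *; apply: sub_eqP; apply: ca_addC.
- by move=> *; apply: sub_eqP; apply: ca_mulC.
- by move=> *; apply: sub_eqP; apply: ca_addA.
- by move=> *; apply: sub_eqP; apply: ca_mulA.
- by move=> *; apply: sub_eqP; apply: ca_absorb1.
- by move=> *; apply: sub_eqP; apply: ca_absorb2.
- by move=> *; apply: sub_eqP; apply: ca_distr.
- by move=> *; apply: sub_eqP; apply: ca_compl1.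
- by move=> *; apply: sub_eqP; apply: ca_compl0.
- by move=> *; apply: sub_eqP; apply: ca_C1.
- by move=> *; apply: sub_eqP; apply: ca_C2.
- by move=> *; apply: sub_eqP; apply: ca_C3.
- by move=> *; apply: sub_eqP; apply: ca_C4.
- by move=> *; apply: sub_eqP; apply: ca_C5.
- by move=> *; apply: sub_eqP; apply: ca_C6.
- by move=> *; apply: sub_eqP; apply: ca_C7.
Defined.

End SubAlgebra.

Section FullSetAlgebra.
Variables (m : nat) (M : Type).

Lemma tuple_off_comm (i j : 'I_m) (x y z : 'I_m -> M) :
  (forall a, a != i -> x a = y a) -> (forall a, a != j -> y a = z a) ->
  exists y', (forall a, a != j -> x a = y' a) /\
             (forall a, a != i -> y' a = z a).
Proof.
move=> xy yz; exists (fun a => if a == j then z a else x a); split=> a.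
  by move/negPf->.
by move=> ai; case: eqVneq => // aj; rewrite xy // yz.
Qed.

Definition full_set_algebra : CA m.
Proof.
refine (@complex_algebra m ('I_m -> M)
  (fun i s t => forall a, a != i -> s a = t a) (fun i j s => s i = s j)
  _ _ _ tuple_off_comm _ _ _).
- by [].
- by move=> i x y xy a ai; rewrite xy.
- by move=> i x y z xy yz a ai; rewrite xy // yz.
- by [].
- move=> i j k s ki kj; split=> [sij|[t [st [tik tkj]]]].
    exists (fun a => if a == k then s i else s a).
    split; first by move=> a /negPf->.
    by rewrite /= eqxx [i == k]eq_sym (negPf ki) [j == k]eq_sym (negPf kj).
  by rewrite st 1?eq_sym // tik tkj st 1?eq_sym.
- move=> i j s t ij st si ti; apply: funext => a.
  have [->|ai] := eqVneq a i; last exact: st.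
  by rewrite si ti st // eq_sym.
Defined.

End FullSetAlgebra.

(** * Types of tuples and tree-like points *)

Section Types.
Variables (m' : nat) (C : Type) (c0 : C).
Local Notation m := m'.+3.
Variable conf : 'I_m -> C -> C -> Prop.

Definition edge0 : C * 'I_m := (c0, ord0).

Record typ := Typ {
  teq : 'I_m -> 'I_m -> bool;
  tsrt : 'I_m -> option 'I_m;
  ted : 'I_m -> 'I_m -> C * 'I_m }.

Lemma typ_eqP t u : (forall a, tsrt t a = tsrt u a) ->
  (forall a b, teq t a b = teq u a b) ->
  (forall a b, ted t a b = ted u a b) -> t = u.
Proof.
case: t u => [e1 s1 d1] [e2 s2 d2] /= hs he hd.
have -> : s1 = s2 by apply: funext.
have -> : e1 = e2 by apply: funext => a; apply: funext => b.
by have -> : d1 = d2 by apply: funext => a; apply: funext => b.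
Qed.

(** A point has no edge to itself; [ted_diag] fixes the junk value, so that the type of a tuple is
    unique. *)
Record congr (t : typ) : Prop := Congr {
  teq_refl : forall a, teq t a a;
  teq_sym : forall a b, teq t a b = teq t b a;
  teq_trans : forall a b c, teq t a b -> teq t b c -> teq t a c;
  tsrt_eq : forall a b, teq t a b -> tsrt t a = tsrt t b;
  ted_eq : forall a b c, teq t a b -> ted t a c = ted t b c;
  ted_sym : forall a b, ted t a b = ted t b a;
  ted_diag : forall a b, teq t a b -> ted t a b = edge0 }.

Definition rule (t : typ) : Prop := forall a b c j, ~~ teq t a b ->
  tsrt t a = None -> tsrt t b = None -> tsrt t c = Some j ->
  (ted t a b).2 = j -> ~ conf j (ted t a c).1 (ted t b c).1.

Definition valid (t : typ) : Prop := congr t /\ rule t.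

Definition agree_on (Q : pred 'I_m) (t u : typ) : Prop :=
  (forall a, Q a -> tsrt t a = tsrt u a) /\
  forall a b, Q a -> Q b -> teq t a b = teq u a b /\ ted t a b = ted u a b.

Lemma agree_on_sym Q t u : agree_on Q t u -> agree_on Q u t.
Proof.
by move=> [hs he]; split=> [a Qa|a b Qa Qb]; [rewrite hs|have [-> ->] := he a b Qa Qb].
Qed.

Lemma agree_on_trans Q t u v :
  agree_on Q t u -> agree_on Q u v -> agree_on Q t v.
Proof.
move=> [hs he] [hs' he']; split=> [a Qa|a b Qa Qb]; first by rewrite hs // hs'.
by have [-> ->] := he a b Qa Qb; apply: he'.
Qed.

Lemma agree_onW (Q Q' : pred 'I_m) t u :
  (forall a, Q a -> Q' a) -> agree_on Q' t u -> agree_on Q t u.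
Proof.
by move=> QQ' [hs he]; split=> [a /QQ'/hs//|a b /QQ' Qa /QQ' Qb]; apply: he.
Qed.

Lemma agree_on_all t u : agree_on xpredT t u -> t = u.
Proof.
by case=> hs he; apply: typ_eqP => [a|a b|a b];
  [exact: hs|exact: (he a b _ _).1|exact: (he a b _ _).2].
Qed.

Definition reindex (h : 'I_m -> 'I_m) (t : typ) : typ :=
  Typ (fun a b => teq t (h a) (h b)) (fun a => tsrt t (h a))
      (fun a b => ted t (h a) (h b)).

Lemma valid_reindex h t : valid t -> valid (reindex h t).
Proof.
case=> -[? ? tr ? ? ? ?] rt; split; last by move=> a b c j; apply: rt.
by split=> //= *; eauto.
Qed.

(** Coordinate [i] is a copy of [j] in both types, so all its data can be read off at [j], where the
    types agree. *)
Lemma agree_off_uniq i j t u : i != j -> congr t -> congr u ->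
  agree_on (predC1 i) t u -> teq t i j -> teq u i j -> t = u.
Proof.
move=> ij ct cu [hs he] ti ui; have ji : predC1 i j by rewrite /= eq_sym.
have He a b : predC1 i b -> teq t a b = teq u a b /\ ted t a b = ted u a b.
  move=> bi; have [->|ai] := eqVneq a i; last exact: he.
  rewrite (ted_eq ct _ ti) (ted_eq cu _ ui); have [E ->] := he j b ji bi.
  split=> //; apply/idP/idP => H.
    apply: (teq_trans cu ui); rewrite -E; apply: (teq_trans ct _ H).
    by rewrite (teq_sym ct).
  apply: (teq_trans ct ti); rewrite E; apply: (teq_trans cu _ H).
  by rewrite (teq_sym cu).
apply: typ_eqP => [a|a b|a b].
- have [->|ai] := eqVneq a i; last exact: hs.
  by rewrite (tsrt_eq ct ti) (tsrt_eq cu ui) hs.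
- have [->|bi] := eqVneq b i; last by have [] := He a b bi.
  rewrite (teq_sym ct) (teq_sym cu).
  have [->|ai] := eqVneq a i; first by rewrite !teq_refl.
  by have [] := He i a ai.
- have [->|bi] := eqVneq b i; last by have [] := He a b bi.
  rewrite (ted_sym ct) (ted_sym cu).
  have [->|ai] := eqVneq a i; first by rewrite !ted_diag // teq_refl.
  by have [] := He i a ai.
Qed.

Definition vtyp := {t : typ | valid t}.

Lemma vtyp_eqP (x y : vtyp) : sval x = sval y -> x = y.
Proof. by case: x y => [x Sx] [y Sy] /= xy; apply: eq_exist. Qed.

Definition vtyp_off (i : 'I_m) (x y : vtyp) : Prop :=
  agree_on (predC1 i) (sval x) (sval y).

Definition vtyp_diag (i j : 'I_m) (x : vtyp) : Prop := teq (sval x) i j.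

Lemma vtyp_diag_cyl i j k x : k != i -> k != j ->
  vtyp_diag i j x <-> exists y, vtyp_off k x y /\ vtyp_diag i k y /\ vtyp_diag k j y.
Proof.
rewrite /vtyp_diag => ki kj; split=> [xij|[y [[_ he] [yik ykj]]]]; last first.
  have ik : predC1 k i by rewrite /= eq_sym.
  have jk : predC1 k j by rewrite /= eq_sym.
  by have [-> _] := he i j ik jk; apply: (teq_trans (svalP y).1 yik ykj).
pose h a := if a == k then i else a.
exists (exist _ _ (valid_reindex h (svalP x))); rewrite /= /h eqxx.
rewrite [i == k]eq_sym (negPf ki) [j == k]eq_sym (negPf kj).
split; last by rewrite (teq_refl (svalP x).1).
by split=> [a|a b] /= /negPf->// /negPf->.
Qed.

Section Structure.
Variables (P : Type) (srt : P -> option 'I_m) (ed : P -> P -> C * 'I_m).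
Hypothesis ed_sym : forall x y, ed x y = ed y x.

Definition typ_of (s : 'I_m -> P) : typ :=
  Typ (fun a b => `[< s a = s b >]) (fun a => srt (s a))
      (fun a b => if `[< s a = s b >] then edge0 else ed (s a) (s b)).

Definition rule3 (x y z : P) : Prop := forall j, x <> y ->
  srt x = None -> srt y = None -> srt z = Some j ->
  (ed x y).2 = j -> ~ conf j (ed x z).1 (ed y z).1.

Lemma congr_typ_of s : congr (typ_of s).
Proof.
split=> /=.
- by move=> a; apply/asboolP.
- by move=> a b; apply/asboolP/asboolP.
- by move=> a b c /asboolP-> /asboolP->; apply/asboolP.
- by move=> a b /asboolP->.
- by move=> a b c /asboolP->.
- move=> a b; rewrite ed_sym; congr (if _ then _ else _).
  by apply/asboolP/asboolP.
- by move=> a b ->.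
Qed.

Lemma ted_typ_of s a b : s a <> s b -> ted (typ_of s) a b = ed (s a) (s b).
Proof. by move=> /= ab; rewrite asboolF. Qed.

Lemma valid_typ_of s :
  (forall a b c, rule3 (s a) (s b) (s c)) -> valid (typ_of s).
Proof.
move=> r; split; first exact: congr_typ_of.
move=> a b c j /asboolP ab sa sb sc; rewrite ted_typ_of // => eab.
(* By its sort the third point differs from the first two, so none of the three edges has the junk
   value. *)
rewrite !ted_typ_of; first exact: (r a b c).
  by move=> E; move: sb sc; rewrite /= E => ->.
by move=> E; move: sa sc; rewrite /= E => ->.
Qed.

(* A type is realised by bringing its points in one at a time, the points not
   yet introduced being kept equal to the first one. *)
Lemma realize (G : ('I_m -> P) -> Prop) :
  (forall r, exists x, srt x = r /\ G (fun _ => x)) ->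
  (forall s i t, G s -> valid t -> agree_on (predC1 i) (typ_of s) t ->
    exists s', G s' /\ typ_of s' = t) ->
  forall t, valid t -> exists s, G s /\ typ_of s = t.
Proof.
move=> Gc Ge t vt.
pose h (k : nat) (a : 'I_m) := if a < k then a else ord0.
have H (k : nat) : k <= m -> exists s, G s /\ typ_of s = reindex (h k) t.
  elim: k => [_|k IH km].
    have [x [sx Gx]] := Gc (tsrt t ord0); exists (fun _ => x); split=> //.
    apply: typ_eqP => // a b; rewrite /h /=.
      by rewrite (teq_refl vt.1); apply/asboolP.
    by rewrite asboolT // (ted_diag vt.1) // (teq_refl vt.1).
  have [s [Gs sE]] := IH (ltnW km).
  apply: (Ge s (Ordinal km)) => //; first exact: valid_reindex.
  have E a : a != Ordinal km -> h k a = h k.+1 a.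
    move=> ak; rewrite /h ltnS [a <= k]leq_eqVlt.
    by have /negPf-> : (a : nat) != k by apply: contra ak => /eqP ak; apply/eqP/val_inj.
  rewrite sE; split=> [a /= /E->//|a b /= /E-> /E-> //].
have [s [Gs sE]] := H m (leqnn _); exists s; split=> //.
by rewrite sE; apply: typ_eqP => [a|a b|a b]; rewrite /= /h !ltn_ord.
Qed.

End Structure.
End Types.

(** * Points that record the points over which they were created *)

Section Trees.
Variables (S E : Type) (N : nat).

(* [Node r i p d] is a point of sort [r] created over the points [p k], [k != i],
   to which it is joined by the edges [d k]; [p i] and [d i] are junk. *)
Inductive tree :=
| Leaf of S
| Node of S & 'I_N & ('I_N -> tree) & ('I_N -> E).

Definition srt (x : tree) : S := match x with Leaf r => r | Node r _ _ _ => r end.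

Fixpoint rank (x : tree) : nat :=
  match x with
  | Leaf _ => 0
  | Node _ _ p _ => (\max_(k < N) rank (p k)).+1
  end.

Definition par (x y : tree) : Prop :=
  match x with Leaf _ => False | Node _ i p _ => exists2 k, k != i & p k = y end.

(** A parent may occupy several slots and [pick] takes any of them; by [lst_Node] the choice is
    immaterial when equal parents carry equal edges. *)
Definition lst (x y : tree) : option E :=
  match x with
  | Leaf _ => None
  | Node _ i p d =>
      if [pick k | (k != i) && `[< p k = y >]] is Some k then Some (d k) else None
  end.

Definition ldat (x y : tree) : option E :=
  if lst x y is Some e then Some e else lst y x.

Lemma rank_par x y : par x y -> rank y < rank x.
Proof.
case: x => // r i p d [k _ <-] /=; rewrite ltnS.
exact: (@leq_bigmax _ (fun k => rank (p k))).
Qed.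

Lemma par_asym x y : par x y -> par y x -> False.
Proof. by move=> /rank_par xy /rank_par; rewrite ltnNge ltnW. Qed.

Lemma parP x y : par x y <-> lst x y <> None.
Proof.
case: x => //= r i p d; case: pickP => [k /andP[ki /asboolP E1]|no].
  by split=> // _; exists k.
split=> // -[k ki E1]; have := no k; rewrite ki /=.
by move/negbT/asboolP/(_ E1).
Qed.

Lemma nparP x y : ~ par x y -> lst x y = None.
Proof. by move=> np; apply: contrapT => /parP. Qed.

(** By rank, at most one of two points is a parent of the other, so the order in which [ldat]
    consults them does not matter. *)
Lemma ldat_sym x y : ldat x y = ldat y x.
Proof.
rewrite /ldat; have [p|/nparP->] := EM (par x y).
  by rewrite (nparP (par_asym p)); case: (lst x y).
by case: (lst y x).
Qed.

Lemma ldat_par x y : par x y -> ldat x y = lst x y.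
Proof. by move/parP; rewrite /ldat; case: (lst x y). Qed.

Lemma ldatP x y : ldat x y <> None <-> par x y \/ par y x.
Proof.
rewrite /ldat; have [p|np] := EM (par x y).
  by move/parP: (p); case: (lst x y) => // e _; split; [left|].
rewrite (nparP np) -(parP y x); split; first by right.
by case.
Qed.

Lemma ldatN x y : ~ par x y -> ~ par y x -> ldat x y = None.
Proof. by move=> ? ?; case E1: ldat => //; have /ldatP[] : ldat x y <> None by rewrite E1. Qed.

Lemma lst_Node r i p d k : (forall a b, a != i -> b != i -> p a = p b -> d a = d b) ->
  k != i -> lst (Node r i p d) (p k) = Some (d k).
Proof.
move=> dp ki; rewrite /=; case: pickP => [a /andP[ai /asboolP E1]|no].
  by rewrite (dp a k).
by have := no k; rewrite ki /=; move/negbT/asboolP/(_ erefl).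
Qed.

Lemma par_Node r i p d k : k != i -> par (Node r i p d) (p k).
Proof. by exists k. Qed.

Lemma Node_neq r i p d k : Node r i p d <> p k.
Proof.
move=> E1; have : rank (p k) < rank (Node r i p d).
  by rewrite /= ltnS; apply: (@leq_bigmax _ (fun k => rank (p k))).
by rewrite E1 ltnn.
Qed.

End Trees.

(** * Square representations *)

Lemma inj_onto (N : nat) (g : 'I_N -> 'I_N) :
  injective g -> forall k, exists j, g j = k.
Proof. by move=> /injF_onto gs k; have /codomP[j ->] := gs k; exists j. Qed.

(** Pigeonhole: if all [N] sorts occurred away from [i], choosing a place for each would give an
    injection of ['I_N] into itself that misses [i]. *)
Lemma missing_sort (N : nat) (f : 'I_N -> option 'I_N) (i : 'I_N) :
  exists j0, forall a, a != i -> f a <> Some j0.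
Proof.
apply: contrapT => /forallNP H.
have {}H j : exists a, a != i /\ f a = Some j.
  by apply: contrapT => /forallNP na; apply: (H j) => a ai fa; apply: (na a).
have [g gP] := choice H.
have gI : injective g by move=> a b ab; have := (gP b).2; rewrite -ab (gP a).2 => -[].
by have [j E] := inj_onto gI i; have := (gP j).1; rewrite E eqxx.
Qed.

Section SquareModel.
Variables (m' n : nat) (C : eqType) (c0 : C).
Local Notation m := m'.+3.
Variable conf : 'I_m -> C -> C -> Prop.
Hypothesis conf_sym : forall j x y, conf j x y -> conf j y x.
Hypothesis fresh : forall j (L : seq C), size L <= n * n + n ->
  exists F : 'I_n -> C, (forall a b, a <> b -> ~ conf j (F a) (F b)) /\
    (forall a x, x \in L -> ~ conf j (F a) x).

Local Notation point := (tree (option 'I_m) (C * 'I_m)%type n).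

Definition sq_ed (x y : point) : C * 'I_m := odflt (edge0 m' c0) (ldat x y).

Definition adj (x y : point) : Prop := x = y \/ ldat x y <> None.

Local Notation rule3 := (rule3 conf (@srt _ _ n) sq_ed).
Local Notation typ_of := (typ_of c0 (@srt _ _ n) sq_ed).
Local Notation valid := (valid c0 conf).

(** These tuples form the unit of the representation. Points that are not [adj] never occur together
    in it, so the trees need not fit together globally. *)
Definition clique (I : Type) (s : I -> point) : Prop :=
  (forall a b, adj (s a) (s b)) /\ (forall a b c, rule3 (s a) (s b) (s c)).

Lemma sq_ed_sym x y : sq_ed x y = sq_ed y x.
Proof. by rewrite /sq_ed ldat_sym. Qed.

Lemma adj_sym x y : adj x y -> adj y x.
Proof. by case=> [->|]; [left|rewrite ldat_sym; right]. Qed.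

Lemma rule3_sym x y z : rule3 x y z -> rule3 y x z.
Proof.
move=> r j yx sy sx sz e cf; apply: (r j) => //; first exact: nesym.
  by rewrite sq_ed_sym.
exact: conf_sym.
Qed.

Lemma valid_typ_of_clique s : clique s -> valid (typ_of s).
Proof. by move=> [_ r]; apply: valid_typ_of => //; apply: sq_ed_sym. Qed.

(* The unspecified edges of the new point get fresh colours, and second
   component a sort [j0] that no specified point has. *)
Lemma extend (s : 'I_n -> point) (j : 'I_n) (Q : pred 'I_n)
    (r : option 'I_m) (d : 'I_n -> C * 'I_m) (j0 : 'I_m) :
  clique s -> ~~ Q j ->
  (forall a, Q a -> srt (s a) <> Some j0) ->
  (forall a b, Q a -> Q b -> s a = s b -> d a = d b) ->
  (r = None -> forall a b i, Q a -> Q b -> srt (s b) = None ->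
     srt (s a) = Some i -> (d b).2 = i -> ~ conf i (d a).1 (sq_ed (s b) (s a)).1) ->
  (forall i, r = Some i -> forall a b, Q a -> Q b -> s a <> s b ->
     srt (s a) = None -> srt (s b) = None -> (sq_ed (s a) (s b)).2 = i ->
     ~ conf i (d a).1 (d b).1) ->
  exists t, [/\ clique t, forall a, a != j -> t a = s a, srt (t j) = r,
    forall a, a != j -> t j <> t a & forall a, Q a -> sq_ed (t j) (t a) = d a].
Proof.
move=> [sadj srule] nQj j0Q dQ HW HK.
(* [L] collects the colours that a fresh one may meet: at most [n * n] between points of [s], and
   [n] specified ones. *)
pose L := [seq (sq_ed (s a) (s b)).1 | a <- enum 'I_n, b <- enum 'I_n]
          ++ [seq (d a).1 | a <- enum 'I_n].
have szL : size L <= n * n + n.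
  by rewrite size_cat size_allpairs size_map size_enum_ord.
have Led a b : (sq_ed (s a) (s b)).1 \in L.
  rewrite mem_cat; apply/orP; left; apply/allpairsP.
  by exists (a, b); rewrite /= !mem_enum.
have Ld a : (d a).1 \in L.
  by rewrite mem_cat; apply/orP; right; apply/mapP; exists a; rewrite ?mem_enum.
have [F FP] := choice (fun i => fresh i szL).
(* The fresh colour of an edge is selected by [kk], the place of its end point in [s], so that
   different points get non-conflicting colours; [jj] is the sort of the end of the edge lying in
   some [K_i], which decides the conflict relation to be avoided. *)
pose kk (x : point) := odflt j [pick b | `[< s b = x >]].
have kkP a : s (kk (s a)) = s a.
  rewrite /kk; case: pickP => [b /asboolP//|/(_ a) /negbT/asboolP/(_ erefl)//].
pose jj (x : point) := if r is Some i then i else odflt ord0 (srt x).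
pose D (x : point) := if [pick b | Q b && `[< s b = x >]] is Some b then d b
            else (F (jj x) (kk x), j0).
have DQ b : Q b -> D (s b) = d b.
  move=> Qb; rewrite /D; case: pickP => [c /andP[Qc /asboolP E]|/(_ b)].
    exact: dQ.
  by rewrite Qb => /negbT/asboolP/(_ erefl).
have DP x : (exists b, [/\ Q b, s b = x & D x = d b]) \/
    (forall b, Q b -> s b <> x) /\ D x = (F (jj x) (kk x), j0).
  have [[b [Qb E]]|no] := EM (exists b, Q b /\ s b = x).
    by left; exists b; split=> //; rewrite -E DQ.
  have {}no b : Q b -> s b <> x by move=> Qb E; apply: no; exists b.
  right; split=> //; rewrite /D; case: pickP => // b /andP[Qb /asboolP E].
  by case: (no b).
pose z : point := Node r j s (fun a => D (s a)).
have zl a : a != j -> ldat z (s a) = Some (D (s a)).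
  move=> aj; rewrite ldat_par; last exact: par_Node.
  by apply: lst_Node => // b c _ _ ->.
have ze a : a != j -> sq_ed z (s a) = D (s a) by move=> aj; rewrite /sq_ed zl.
have Qj a : Q a -> a != j by move=> Qa; apply: contraNneq nQj => <-.
have zadj a : a != j -> adj z (s a) by move=> aj; right; rewrite zl.
pose t a := if a == j then z else s a.
have tj : t j = z by rewrite /t eqxx.
have ta a : a != j -> t a = s a by rewrite /t => /negPf->.
(* The new point is in [W]. If [s b] is unspecified, the index is [j0], so [s c] has sort [j0]; then
   it is unspecified too and its colour is fresh. *)
have rW b c : b != j -> c != j -> rule3 z (s b) (s c).
  move=> bj cj i _ sz sb sc; rewrite !ze //= => Ei cf.
  have [[b' [Qb' Eb Db]]|[nb Db]] := DP (s b); last first.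
    have [[c' [Qc' Ec Dc]]|[nc Dc]] := DP (s c).
      by apply: (j0Q c' Qc'); rewrite Ec sc -Ei Db.
    move: cf; rewrite Dc /= /jj /= sc (sz : r = None) /=.
    exact: (FP i).2.
  rewrite -Eb in sb cf Db Ei *.
  have [[c' [Qc' Ec Dc]]|[nc Dc]] := DP (s c).
    rewrite -Ec in sc cf Dc.
    by apply: (HW sz c' b' i) => //; rewrite ?DQ // in cf Ei *.
  move: cf; rewrite Dc /= /jj /= sc (sz : r = None) /=.
  exact: (FP i).2.
(* The new point is in some [K_i]: a fresh colour conflicts neither with a specified one nor with
   another fresh one. *)
have rK a b : a != j -> b != j -> rule3 (s a) (s b) z.
  move=> aj bj i ab sa sb sz Ei; rewrite ![sq_ed _ z]sq_ed_sym !ze //= => cf.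
  have [[b' [Qb' Eb Db]]|[nb Db]] := DP (s b);
  have [[a' [Qa' Ea Da]]|[na Da]] := DP (s a); rewrite Da Db /= in cf.
  - by apply: (HK i sz a' b') => //; rewrite ?Ea ?Eb.
  - by move: cf; rewrite /jj /= (sz : r = Some i); apply: (FP i).2.
  - move/conf_sym: cf; rewrite /jj /= (sz : r = Some i); exact: (FP i).2.
  - move: cf; rewrite /jj /= (sz : r = Some i); apply: (FP i).1.
    by move=> E; apply: ab; rewrite -(kkP a) -(kkP b) E.
exists t; split=> //.
- split.
    move=> a b; have [->|aj] := eqVneq a j; have [->|bj] := eqVneq b j;
      rewrite ?tj ?ta //; first by left.
      exact: zadj.
    by apply: adj_sym; apply: zadj.
  move=> a b c; have [->|aj] := eqVneq a j; have [->|bj] := eqVneq b j;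
  have [->|cj] := eqVneq c j; rewrite ?tj ?ta //.
  + by move=> i _ sz _; rewrite sz.
  + exact: rW.
  + by move=> i _ _ sz; rewrite sz.
  + by apply: rule3_sym; apply: rW.
  + exact: rK.
- by rewrite tj.
- by move=> a aj; rewrite tj ta //; apply: Node_neq.
- by move=> a Qa; rewrite tj ta ?Qj // ze ?Qj // DQ.
Qed.


Lemma clique_comp (I J : Type) (s : I -> point) (g : J -> I) :
  clique s -> clique (s \o g).
Proof. by case=> sa sr; split=> *; [apply: sa|apply: sr]. Qed.

(** Only the coordinates in [Q] constrain the new point. Leaving [Q] smaller than the complement of
    [i] serves both to realise types from scratch and to amalgamate them in [vtyp_off_comm]. *)
Lemma extend_typ (s : 'I_n -> point) (l : 'I_m -> 'I_n) i (Q : pred 'I_m) t :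
  clique s -> injective l -> valid t -> ~~ Q i ->
  agree_on Q (typ_of (s \o l)) t ->
  exists s', [/\ clique s', forall a, a != l i -> s' a = s a &
    agree_on (fun a => (a == i) || Q a) (typ_of (s' \o l)) t].
Proof.
move=> cs lI vt nQi [hs he]; have ct := vt.1.
(* If [t] identifies [i] with a coordinate in [Q], the point found there is reused. *)
have [[a [Qa ta]]|no] := EM (exists a, Q a /\ teq t i a).
  pose g b := if b == l i then l a else b.
  pose h b := if b == i then a else b.
  exists (s \o g); split; first exact: clique_comp.
    by move=> b /negPf bi; rewrite /= /g bi.
  have gl b : g (l b) = l (h b) by rewrite /g /h inj_eq //; case: ifP.
  have th b : teq t b (h b).
    by rewrite /h; case: eqVneq => [->//|_]; apply: teq_refl ct _.
  have Qh b : (b == i) || Q b -> Q (h b) by rewrite /h; case: eqVneq.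
  split=> [b /Qh Qb|b c /Qh Qb /Qh Qc].
    by rewrite (tsrt_eq ct (th b)) -hs //= gl.
  have [E1 E2] := he _ _ Qb Qc.
  rewrite (ted_eq ct _ (th b)) (ted_sym ct) (ted_eq ct _ (th c)) (ted_sym ct) -E2.
  split; last by rewrite /= !gl.
  rewrite [LHS](_ : _ = teq (typ_of (s \o l)) (h b) (h c)); last by rewrite /= !gl.
  rewrite E1; apply/idP/idP => H.
    apply: (teq_trans ct (th b)); apply: (teq_trans ct H).
    by rewrite (teq_sym ct) th.
  rewrite (teq_sym ct) in H; apply: (teq_trans ct _ (th c)).
  by rewrite (teq_sym ct); apply: (teq_trans ct H).
have nta a : Q a -> teq t i a = false.
  by move=> Qa; apply/negP => H; apply: no; exists a.
pose Q' b := [exists a, Q a && (l a == b)].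
pose d b := if [pick a | Q a && (l a == b)] is Some a then ted t i a
            else edge0 m' c0.
have dl a : Q a -> d (l a) = ted t i a.
  move=> Qa; rewrite /d; case: pickP => [b /andP[_ /eqP/lI->]//|/(_ a)].
  by rewrite Qa eqxx.
have Q'P b : Q' b -> exists2 a, Q a & b = l a.
  by move/existsP=> [a /andP[Qa /eqP<-]]; exists a.
have neq a b : Q a -> Q b -> s (l a) <> s (l b) -> ~~ teq t a b.
  by move=> Qa Qb ab; rewrite -(he a b Qa Qb).1 /=; apply/asboolP.
have tsq a b : Q a -> Q b -> s (l a) <> s (l b) ->
    sq_ed (s (l a)) (s (l b)) = ted t a b.
  move=> Qa Qb ab; rewrite -(he a b Qa Qb).2 /= asboolF //.
have hs' a : Q a -> srt (s (l a)) = tsrt t a by move=> /hs.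
have [j0 j0P] := missing_sort (tsrt t) i.
have Qn a : Q a -> a != i by move=> Qa; apply: contraNneq nQi => <-.
have [|||||s' [cs' s's r' ne' d']] :=
  @extend s (l i) Q' (tsrt t i) d j0 cs.
- by apply/negP => /Q'P[a Qa /lI ia]; move: nQi; rewrite ia Qa.
- by move=> b /Q'P[a Qa ->]; rewrite hs' //; apply: j0P; apply: Qn.
- move=> _ _ /Q'P[a Qa ->] /Q'P[b Qb ->] ab; rewrite !dl //.
  rewrite (ted_sym ct) (ted_sym ct i); apply: (ted_eq ct).
  by rewrite -(he a b Qa Qb).1; apply/asboolP.
- move=> ri _ _ j /Q'P[a Qa ->] /Q'P[b Qb ->]; rewrite !hs' // => sb sa.
  rewrite !dl // tsq //; last by move=> E; move: sb; rewrite -hs' // E hs' // sa.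
  by apply: vt.2 => //; rewrite nta.
- move=> j ri _ _ /Q'P[a Qa ->] /Q'P[b Qb ->] ab; rewrite !hs' // => sa sb.
  rewrite tsq // !dl // ![ted t i _](ted_sym ct) => E.
  by apply: vt.2 => //; apply: neq.
exists s'; split=> //.
have li a : Q a -> l a != l i by move=> Qa; rewrite inj_eq // Qn.
have s'l a : Q a -> s' (l a) = s (l a) by move=> Qa; rewrite s's // li.
have Ql a : Q a -> Q' (l a) by move=> Qa; apply/existsP; exists a; rewrite Qa eqxx.
split=> [a|a b].
  by case: eqVneq => [-> _|_ /= Qa] //=; rewrite s'l //; apply: hs'.
case: (eqVneq a i) => [-> _|_ /= Qa]; case: (eqVneq b i) => [-> _|_ /= Qb].
- rewrite (teq_refl ct) (ted_diag ct) ?(teq_refl ct) //=.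
  by rewrite asboolT.
- rewrite nta //= asboolF; last by apply: ne'; apply: li.
  by rewrite d' ?Ql // dl.
- rewrite (teq_sym ct) (ted_sym ct) nta //= asboolF; last first.
    by apply: nesym; apply: ne'; apply: li.
  by rewrite sq_ed_sym d' ?Ql // dl.
- by have := he a b Qa Qb; rewrite /= !s'l.
Qed.

Lemma clique_const (I : Type) x : clique (fun _ : I => x).
Proof. by split=> [a b|a b c j /(_ erefl)//]; left. Qed.

Hypothesis le_mn : m <= n.
Local Notation widen := (widen_ord le_mn).

Lemma widen_inj : injective widen.
Proof. by move=> a b /(congr1 val) /= ab; apply: val_inj. Qed.

Lemma realize_clique t : valid t -> exists s : 'I_n -> point,
  clique s /\ typ_of (s \o widen) = t.
Proof.
move=> vt.
have H (k : nat) : k <= m -> exists s : 'I_n -> point, clique s /\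
    agree_on (fun a : 'I_m => a < k) (typ_of (s \o widen)) t.
  elim: k => [_|k IH km].
    by exists (fun _ => Leaf _ _ None); split; [apply: clique_const|split].
  have [s [cs sE]] := IH (ltnW km).
  have [|s' [cs' _ sE']] := extend_typ (i := Ordinal km) cs widen_inj vt _ sE.
    by rewrite /= ltnn.
  exists s'; split=> //; apply: agree_onW sE' => a.
  by rewrite ltnS leq_eqVlt => /orP[/eqP ak|->]; rewrite ?orbT // -val_eqE /= ak eqxx.
have [s [cs sE]] := H m (leqnn _); exists s; split=> //; apply: agree_on_all.
by apply: agree_onW sE => a _; apply: ltn_ord.
Qed.

(** Realise [x] by a clique and replace its point at [j] by one of the type that [z] prescribes over
    the coordinates other than [i] and [j]; [extend_typ] leaves its edge to the point at [i]
    free. *)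
Lemma vtyp_off_comm i j (x y z : vtyp c0 conf) : vtyp_off i x y ->
  vtyp_off j y z -> exists y', vtyp_off j x y' /\ vtyp_off i y' z.
Proof.
have [<-|ij] := eqVneq i j => xy yz; first by exists y.
have [s [cs sE]] := realize_clique (svalP x).
have [||s' [cs' s's sE']] :=
    @extend_typ s widen j (fun a => (a != i) && (a != j)) (sval z) cs widen_inj (svalP z).
- by rewrite eqxx andbF.
- rewrite sE; apply: (@agree_on_trans _ _ _ _ (sval y)).
    by apply: agree_onW xy => a /andP[].
  by apply: agree_onW yz => a /andP[].
have vs' := valid_typ_of_clique (clique_comp widen cs').
exists (exist _ _ vs'); split.
  rewrite /vtyp_off /= -sE; have E a : a != j -> s (widen a) = s' (widen a).
    by move=> aj; rewrite s's // (inj_eq widen_inj).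
  by split=> [a /= /E->//|a b /= /E-> /E->].
by apply: agree_onW sE' => a /= ai; case: eqVneq => //=; rewrite ai.
Qed.

Lemma vtyp_off_uniq i j (x y : vtyp c0 conf) : i != j -> vtyp_off i x y ->
  vtyp_diag i j x -> vtyp_diag i j y -> x = y.
Proof.
move=> ij xy dx dy; apply: vtyp_eqP.
exact: (agree_off_uniq ij (svalP x).1 (svalP y).1 xy).
Qed.

Definition typ_algebra : CA m :=
  @complex_algebra m (vtyp c0 conf) (@vtyp_off _ _ _ conf) (@vtyp_diag _ _ _ conf)
    (fun i x => conj (fun _ _ => erefl) (fun _ _ _ _ => conj erefl erefl))
    (fun i x y => @agree_on_sym _ _ _ _ _)
    (fun i x y z => @agree_on_trans _ _ _ _ _ _)
    vtyp_off_comm (fun i x => teq_refl (svalP x).1 i)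
    (@vtyp_diag_cyl _ _ _ conf) vtyp_off_uniq.

Definition sq_rep (X : typ_algebra) (s : 'I_m -> point) : Prop :=
  clique s /\ exists v : valid (typ_of s), X (exist _ _ v).

Lemma typ_algebra_ext (X : typ_algebra) (x : vtyp c0 conf) t (v : valid t) :
  sval x = t -> X x -> X (exist _ _ v).
Proof. by move=> E Xx; rewrite (_ : exist _ _ v = x) //; apply: vtyp_eqP. Qed.

Lemma sq_rep_rel : is_rel_rep (A := typ_algebra) (@clique 'I_m) sq_rep.
Proof.
split; [|split; [|split; [|split; [|split; [|split; [|split; [|split; [|split]]]]]]]].
- by move=> x; exists (fun _ => x); split; [apply: clique_const|exists ord0].
- by move=> X s [].
- move=> X Y s; split=> [[cs [v [Xv|Yv]]]|[[cs [v Xv]]|[cs [v Yv]]]].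
  + by left; split=> //; exists v.
  + by right; split=> //; exists v.
  + by split=> //; exists v; left.
  + by split=> //; exists v; right.
- move=> X Y s; split=> [[cs [v [Xv Yv]]]|[[cs [v Xv]] [_ [v' Yv]]]].
    by split; split=> //; exists v.
  by split=> //; exists v; split=> //; apply: typ_algebra_ext Yv.
- move=> X s; split=> [[cs [v nXv]]|[cs nX]].
    by split=> // -[_ [v' Xv]]; apply: nXv; apply: typ_algebra_ext Xv.
  split=> //; exists (valid_typ_of_clique cs) => Xv; apply: nX; split=> //.
  by exists (valid_typ_of_clique cs).
- by move=> s [_ []].
- move=> s; split=> [[]//|cs]; split=> //.
  by exists (valid_typ_of_clique cs).
- move=> i X s; split.
    move=> [cs [v [x [sx Xx]]]]; split=> //.
    (* [extend_typ] acts on [n]-tuples, so [s] is padded with its entry at [ord0], the default value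
       of [inord]. *)
    pose s1 (a : 'I_n) := s (inord a).
    have s1w : s1 \o widen = s.
      by apply: funext => a; rewrite /s1 /=; congr s; apply: val_inj; rewrite /= inordK.
    have [|||s' [cs' s's sE']] := @extend_typ s1 widen i (predC1 i) (sval x)
      _ widen_inj (svalP x).
    + exact: clique_comp cs.
    + by rewrite /= eqxx.
    + by rewrite s1w.
    have {}sE' : typ_of (s' \o widen) = sval x.
      by apply: agree_on_all; apply: agree_onW sE' => a _ /=; apply: orbN.
    exists (s' \o widen); split; last first.
      by move=> a ai; rewrite -s1w /= s's // (inj_eq widen_inj).
    have cw := clique_comp widen cs'; split=> //.
    by exists (valid_typ_of_clique cw); apply: typ_algebra_ext Xx.
  move=> [cs [t [[ct [v Xv]] ts]]]; split=> //.
  exists (valid_typ_of_clique cs), (exist _ _ v); split=> //.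
  by split=> [a /= /ts->//|a b /= /ts-> /ts->].
- move=> i j s; split=> [[cs [v /asboolP//]]|[cs sij]]; split=> //.
  by exists (valid_typ_of_clique cs); apply/asboolP.
- move=> X Y XY; apply: pred_eqP => x.
  have [s [cs sE]] := realize_clique (svalP x).
  have cw := clique_comp widen cs; have vw := valid_typ_of_clique cw.
  have {}XY : X (exist _ _ vw) <-> Y (exist _ _ vw).
    split=> H.
      have [|_ [v]] := (XY (s \o widen)).1; first by split=> //; exists vw.
      exact: typ_algebra_ext.
    have [|_ [v]] := (XY (s \o widen)).2; first by split=> //; exists vw.
    exact: typ_algebra_ext.
  by rewrite (_ : x = exist _ _ vw) //; apply: vtyp_eqP.
Qed.

(** Being a clique is a condition on triples, and any three points fit into an [m]-tuple because
    [m >= 3]. *)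
Lemma clique_tuple_clique (s : 'I_n -> point) :
  clique_tuple (@clique 'I_m) s -> clique s.
Proof.
move=> cs; pose g (a b c : 'I_n) (k : 'I_m) :=
  if k == 0 :> nat then a else if k == 1 :> nat then b else c.
split=> [a b|a b c].
  by have [+ _] := cs (g a b b) => /(_ ord0 (inord 1)); rewrite /g /= inordK.
have [_ /(_ ord0 (inord 1) (inord 2))] := cs (g a b c).
by rewrite /g /= !inordK.
Qed.

Lemma sq_rep_square : n_square (A := typ_algebra) n (@clique 'I_m) sq_rep.
Proof.
move=> s X i l /clique_tuple_clique cs lI [_ [v [x [sx Xx]]]].
have [||s' [cs' s's sE']] := @extend_typ s l i (predC1 i) (sval x) cs lI (svalP x).
- by rewrite /= eqxx.
- exact: sx.
have {}sE' : typ_of (s' \o l) = sval x.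
  by apply: agree_on_all; apply: agree_onW sE' => a _ /=; apply: orbN.
exists s'; split; first by move=> g; apply: clique_comp cs'.
split=> //; have cw := clique_comp l cs'; split=> //.
by exists (valid_typ_of_clique cw); apply: typ_algebra_ext Xx.
Qed.

Lemma typ_algebra_square : has_n_square_rep typ_algebra n.
Proof.
by exists point, (@clique 'I_m), sq_rep; split; [apply: sq_rep_rel|apply: sq_rep_square].
Qed.

End SquareModel.

(** * Failure of flatness *)

Section NotFlat.
Variables (m' n : nat) (C : eqType) (c0 : C).
Local Notation m := m'.+3.
Variable conf : 'I_m -> C -> C -> Prop.
Hypothesis conf_sym : forall j x y, conf j x y -> conf j y x.
Hypothesis fresh : forall j (L : seq C), size L <= n * n + n ->
  exists F : 'I_n -> C, (forall a b, a <> b -> ~ conf j (F a) (F b)) /\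
    (forall a x, x \in L -> ~ conf j (F a) x).
Hypothesis le_mn : m <= n.
Hypothesis le_m2n : m + 2 <= n.
Variables (q : nat) (cls : C -> 'I_q) (lab : nat -> C).
Hypothesis conf_cls : forall x y, cls x = cls y -> conf ord0 x y.
Hypothesis conf_lab : forall j i i', j != ord0 -> i <> i' -> conf j (lab i) (lab i').
Hypothesis lab_inj : injective lab.

Local Notation A := (typ_algebra c0 conf_sym fresh le_mn).
Local Notation widen := (widen_ord le_mn).
Local Notation edge0 := (edge0 m' c0).

Definition sing (t : typ m' C) : A := fun x => sval x = t.

(** These elements depend on two coordinates only and thus act as binary relations on the points of
    a representation. *)
Definition pair_elt (a b : 'I_m) (P : option 'I_m -> option 'I_m -> C * 'I_m -> Prop) : A :=
  fun x => P (tsrt (sval x) a) (tsrt (sval x) b) (ted (sval x) a b).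

Definition ktyp : typ m' C := Typ (fun a b => a == b) Some (fun _ _ => edge0).

Lemma valid_ktyp : valid c0 conf ktyp.
Proof.
by split=> //; split=> //= [a b c /eqP->//|a b /eqP->].
Qed.

(** The point [w_i] takes coordinate [ord0], in place of the point of [K_0], so its colour towards
    the latter is left open. *)
Definition wtyp (i : nat) : typ m' C :=
  Typ (fun a b => a == b) (fun a => if a == ord0 then None else Some a)
    (fun a b => if (a == ord0) (+) (b == ord0) then (lab i, ord0) else edge0).

Lemma valid_wtyp i : valid c0 conf (wtyp i).
Proof.
split; last first.
  move=> a b c j /= ab; case: (eqVneq a ord0) => // a0 _.
  by case: (eqVneq b ord0) => // b0; rewrite a0 b0 eqxx in ab.
split=> //= [a b c /eqP->//|a b /eqP->//|a b c /eqP->//|a b|a b /eqP->].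
- by rewrite addbC.
- by rewrite addbb.
Qed.

Let i1 : 'I_m := Ordinal (isT : 1 < m).
Let i2 : 'I_m := Ordinal (isT : 2 < m).

(** * Reading two-coordinate information in an arbitrary representation *)

Section Rep.
Variables (M : Type) (V : ('I_m -> M) -> Prop) (f : A -> ('I_m -> M) -> Prop).
Hypothesis fP : is_rel_rep V f.

Lemma rep_V a s : f a s -> V s. Proof. by case: fP => _ [+ _]; apply. Qed.

Lemma rep_and (X Y : A) s : f X s -> f Y s -> f (fun x => X x /\ Y x) s.
Proof. by case: fP => _ [_ [_ [H _]]] fX fY; apply/(H X Y s). Qed.

Lemma rep_not (X : A) s : V s -> ~ f X s -> f (fun x => ~ X x) s.
Proof. by case: fP => _ [_ [_ [_ [H _]]]] Vs nX; apply/(H X s). Qed.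

Lemma rep_False s : ~ f (fun _ => False) s.
Proof. by case: fP => _ [_ [_ [_ [_ [H _]]]]]; apply: H. Qed.

Lemma rep_True s : V s -> f (fun _ => True) s.
Proof. by case: fP => _ [_ [_ [_ [_ [_ [H _]]]]]] Vs; apply/(H s). Qed.

Lemma rep_cyl i (X : A) s : f (ca_c i X) s <-> rel_c V i (f X) s.
Proof. by case: fP => _ [_ [_ [_ [_ [_ [_ [H _]]]]]]]; apply: H. Qed.

Lemma rep_diag i j s : f (fun x => vtyp_diag i j x) s <-> rel_d V i j s.
Proof. by case: fP => _ [_ [_ [_ [_ [_ [_ [_ [H _]]]]]]]]; apply: H. Qed.

Lemma rep_inj (X Y : A) : (forall s, f X s <-> f Y s) -> X = Y.
Proof. by case: fP => _ [_ [_ [_ [_ [_ [_ [_ [_ H]]]]]]]]; apply: H. Qed.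

Lemma rep_mono (X Y : A) s : (forall x, X x -> Y x) -> f X s -> f Y s.
Proof.
move=> XY fX; have [//|nY] := EM (f Y s); have [] := @rep_False s.
have := rep_and fX (rep_not (rep_V fX) nY).
by rewrite (_ : (fun x => X x /\ ~ Y x) = (fun _ => False)) //;
  apply: pred_eqP => x; split=> // -[/XY].
Qed.

(** The cases are excluded one after another. A representation preserves finite joins only, which is
    why the stages have finitely many colour classes. *)
Lemma rep_cases (k : nat) (X : 'I_k -> A) s :
  V s -> (forall x, exists c, X c x) -> exists c, f (X c) s.
Proof.
move=> Vs Xc; apply: contrapT => /forallNP no.
have H (j : nat) : j <= k -> f (fun x => forall c : 'I_k, c < j -> ~ X c x) s.
  elim: j => [_|j IH jk]; first by apply: rep_mono (rep_True Vs).
  have := rep_and (IH (ltnW jk)) (rep_not Vs (no (Ordinal jk))).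
  apply: rep_mono => x [H1 H2] c; rewrite ltnS leq_eqVlt => /orP[/eqP cj|]; last exact: H1.
  by rewrite (_ : c = Ordinal jk) //; apply: val_inj.
apply: (@rep_False s); apply: rep_mono (H k (leqnn _)) => x Hx.
by have [c Xcx] := Xc x; apply: (Hx c).
Qed.

Lemma rep_nonempty (t : typ m' C) : valid c0 conf t -> exists s, f (sing t) s.
Proof.
move=> v; apply: contrapT => /forallNP no.
have : sing t = (fun _ => False).
  by apply: rep_inj => s; split=> [/no//|/rep_False].
by move=> /(congr1 (fun X => X (exist _ _ v))) E; have : sing t (exist _ _ v) by []; rewrite E.
Qed.

Section Clique.
Variable u : 'I_n -> M.
Hypothesis cu : clique_tuple V u.

(** The other entries are exchanged one at a time: cylindrifying [pair_elt a b P] at a coordinate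
    other than [a] and [b] does not enlarge it. All intermediate tuples are in [V] since [u] ranges
    over a clique. *)
Lemma pair_elt_eq_on a b P (g g' : 'I_m -> 'I_n) : g a = g' a -> g b = g' b ->
  f (pair_elt a b P) (u \o g) -> f (pair_elt a b P) (u \o g').
Proof.
move=> ga gb fg.
pose h (k : nat) (c : 'I_m) := if c < k then g' c else g c.
have H (k : nat) : k <= m -> f (pair_elt a b P) (u \o h k).
  elim: k => [_|k IH km]; first by rewrite (_ : h 0 = g).
  have {}IH := IH (ltnW km); set o := Ordinal km.
  have hE c : c != o -> h k.+1 c = h k c.
    move=> co; rewrite /h ltnS leq_eqVlt (_ : (c == k :> nat) = false) //.
    by apply/negbTE; apply: contra co => /eqP ck; apply/eqP/val_inj.
  have [/orP oab|/norP[oa ob]] := boolP ((o == a) || (o == b)).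
    rewrite (_ : h k.+1 = h k) //; apply: funext => c.
    have [->|/hE//] := eqVneq c o; rewrite /h /= ltnn leqnn.
    by case: oab => /eqP->.
  apply: (@rep_mono (ca_c o (pair_elt a b P : A))).
    move=> x [z [[hs he] Pz]]; move: Pz; rewrite /pair_elt.
    by rewrite -!hs ?(he a b _ _).2 //= eq_sym.
  apply/rep_cyl; split; first exact: cu.
  by exists (u \o h k); split=> // c co; rewrite /= hE.
have := H m (leqnn _); rewrite (_ : h m = g') //.
by apply: funext => c; rewrite /h ltn_ord.
Qed.

(** Equal entries put the tuple into a diagonal element, below which a type has the same sort and
    edges at both coordinates. *)
Lemma pair_elt_move_l a a' b P (g : 'I_m -> 'I_n) : g a = g a' ->
  f (pair_elt a b P) (u \o g) -> f (pair_elt a' b P) (u \o g).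
Proof.
move=> ga fg; have fd : f (fun x => vtyp_diag a a' x) (u \o g).
  by apply/rep_diag; split; [exact: cu|rewrite /= ga].
apply: rep_mono (rep_and fg fd) => x; rewrite /pair_elt => -[+ d].
have cx := (svalP x).1; by rewrite (tsrt_eq cx d) (ted_eq cx _ d).
Qed.

Lemma pair_elt_move_r a b b' P (g : 'I_m -> 'I_n) : g b = g b' ->
  f (pair_elt a b P) (u \o g) -> f (pair_elt a b' P) (u \o g).
Proof.
move=> gb fg; have fd : f (fun x => vtyp_diag b b' x) (u \o g).
  by apply/rep_diag; split; [exact: cu|rewrite /= gb].
apply: rep_mono (rep_and fg fd) => x; rewrite /pair_elt => -[+ d].
have cx := (svalP x).1.
by rewrite (tsrt_eq cx d) !(ted_sym cx a) (ted_eq cx _ d).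
Qed.

(** The information passes through [h], which takes only two values: its entries at [b] and [i2] are
    equal, so [pair_elt_move_r] applies. *)
Lemma pair_elt_02 b P (g g' : 'I_m -> 'I_n) : b != ord0 ->
  g ord0 = g' ord0 -> g b = g' i2 ->
  f (pair_elt ord0 b P) (u \o g) -> f (pair_elt ord0 i2 P) (u \o g').
Proof.
move=> b0 g0 gb fg; pose h (c : 'I_m) := if c == ord0 then g ord0 else g b.
apply: (@pair_elt_eq_on _ _ _ h); rewrite /h //=.
apply: (@pair_elt_move_r _ b); rewrite /= ?(negPf b0) //.
by apply: pair_elt_eq_on fg; rewrite //= (negPf b0).
Qed.

Lemma pair_elt_12 b P (g g' : 'I_m -> 'I_n) : b != ord0 ->
  g ord0 = g' i1 -> g b = g' i2 ->
  f (pair_elt ord0 b P) (u \o g) -> f (pair_elt i1 i2 P) (u \o g').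
Proof.
move=> b0 g0 gb fg.
pose h (c : 'I_m) := if c == i2 then g b else g ord0.
apply: (@pair_elt_eq_on _ _ _ h) => //; apply: (@pair_elt_move_l ord0) => //.
exact: pair_elt_02 fg.
Qed.

End Clique.
End Rep.

Theorem typ_algebra_not_flat : ~ has_n_flat_rep A n.
Proof.
move=> [M [V [f [fP [sq flat]]]]].
have ltp : m < n by rewrite (leq_trans _ le_m2n) // addn2.
have ltq : m.+1 < n by rewrite (leq_trans _ le_m2n) // addn2.
(* Positions below [m] are for [K]; [p] and [q'] are the two spare ones that [n >= m + 2]
   provides. *)
pose p : 'I_n := Ordinal ltp; pose q' : 'I_n := Ordinal ltq.
have wp c : widen c != p by rewrite -val_eqE /= ltn_eqF.
have wq c : widen c != q' by rewrite -val_eqE /= ltn_eqF // ltnS ltnW.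
have pq : p != q' by rewrite -val_eqE /= ltn_eqF.
have qp : q' != p by rewrite eq_sym.
have wI : injective widen by exact: widen_inj.
pose h (k : nat) (a : 'I_m) := if a < k then a else ord0.
have [y [cy yk yp]] : exists y : 'I_n -> M, [/\ clique_tuple V y,
    f (sing ktyp) (y \o widen) & forall a : 'I_n, m <= a -> y a = y (widen ord0)].
  (* A tuple in [V] need not range over a clique, but a constant one does; from there squareness
     brings in the points of [K] one by one, those not yet introduced being copies of the point of
     [K_0]. *)
  have H (k : nat) : k < m -> exists y : 'I_n -> M, [/\ clique_tuple V y,
    f (sing (reindex (h k.+1) ktyp)) (y \o widen) &
    forall a : 'I_n, m <= a -> y a = y (widen ord0)].
    elim: k => [_|k IH km].
      have [s fs] := rep_nonempty fP (valid_reindex (h 1) valid_ktyp).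
      have sc a : s a = s ord0.
        have : f (fun x => vtyp_diag a ord0 x) s.
          apply: (rep_mono fP) fs => x; rewrite /vtyp_diag /sing => ->.
          by rewrite /= /h; case: a => -[].
        by move/(rep_diag fP) => [].
      have sE : s = (fun _ => s ord0) by apply: funext.
      exists (fun _ => s ord0); split=> //; last by rewrite /comp -sE.
      by move=> g; rewrite -sE; apply: (rep_V fP fs).
    have [y [cy fy yp]] := IH (ltnW km); set o := Ordinal km.
    have [|t [ct [ty ft]]] := sq y (sing (reindex (h k.+2) ktyp)) o widen cy wI.
      apply: (rep_mono fP) fy => x; rewrite /sing => xE.
      exists (exist _ _ (valid_reindex (h k.+2) valid_ktyp)); split=> //.
      rewrite /vtyp_off xE /=.
      have E a : a != o -> h k.+1 a = h k.+2 a.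
        move=> ao; rewrite /h ![_ < k.+2]ltnS [a <= k.+1]leq_eqVlt.
        rewrite (_ : (a == k.+1 :> nat) = false) //.
        by apply/negbTE; apply: contra ao => /eqP ak; apply/eqP/val_inj.
      by split=> [a /E /= ->//|a b /E aE /E bE]; rewrite /= aE bE.
    exists t; split=> // a ma; rewrite ty; last first.
      by rewrite -val_eqE /= gtn_eqF // (leq_trans _ ma).
    by rewrite ty ?(inj_eq wI) //; apply: yp.
  have [y [cy fy yp]] := H m'.+2 (leqnn _); exists y; split=> //.
  rewrite (_ : ktyp = reindex (h m) ktyp) //.
  by apply: typ_eqP => [a|a b|a b]; rewrite /= /h ?ltn_ord.
have ypp : y p = y (widen ord0) by apply: yp.
have yqq : y q' = y (widen ord0) by apply: yp; rewrite /= leqW.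
(* [l o] puts the point at [o] in front of the points of [K] outside [K_0]; [g o w] below has [o]
   once and [w] at all other coordinates. *)
pose l (o : 'I_n) (c : 'I_m) := if c == ord0 then o else widen c.
have lI o : (forall c, widen c != o) -> injective (l o).
  move=> wo a b; rewrite /l; case: eqVneq => [->|a0]; case: eqVneq => [->|b0] //.
  - by move=> E; have := wo b; rewrite -E eqxx.
  - by move=> E; have := wo a; rewrite E eqxx.
  - exact: wI.
have lw o : y o = y (widen ord0) -> y \o l o = y \o widen.
  by move=> yo; apply: funext => c; rewrite /l /=; case: eqVneq => // ->.
pose g (o w : 'I_n) (c : 'I_m) := if c == ord0 then o else w.
pose Pw (j : 'I_m) (X : C -> Prop) (s1 s2 : option 'I_m) (e : C * 'I_m) :=
  [/\ s1 = None, s2 = Some j & X e.1].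
pose Bc c : A := pair_elt ord0 i1 (Pw ord0 (fun e => cls e = c)).
(* Squareness supplies [w_i] at position [p], and [rep_cases] finds a class for its colour towards
   the point of [K_0]. *)
have demand (i : nat) : exists tc : ('I_n -> M) * 'I_q, [/\ clique_tuple V tc.1,
    forall a, a != p -> tc.1 a = y a, f (sing (wtyp i)) (tc.1 \o l p) &
    f (Bc tc.2) (tc.1 \o g p (widen ord0))].
  have [|t [ct [ty ft]]] := sq y (sing (wtyp i)) ord0 (l p) cy (lI _ wp).
    rewrite -/(y \o l p) lw //; apply: (rep_mono fP) yk => x; rewrite /sing => xE.
    exists (exist _ _ (valid_wtyp i)); split=> //; rewrite /vtyp_off xE.
    split=> [a|a b] /= /negPf-> // /negPf->; by split.
  have tw c : t (widen c) = y (widen c) by rewrite ty.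
  have tk : f (sing ktyp) (t \o widen).
    by rewrite (_ : t \o widen = y \o widen) //; apply: funext => c /=.
  have sK : f (pair_elt i1 i1 (fun s _ _ => s = Some ord0) : A) (t \o g p (widen ord0)).
    apply: (@pair_elt_eq_on _ _ _ fP _ ct _ _ _ (fun _ => widen ord0)) => //.
    apply: (@pair_elt_move_l _ _ _ fP _ ct ord0) => //.
    apply: (@pair_elt_move_r _ _ _ fP _ ct _ ord0) => //.
    apply: (@pair_elt_eq_on _ _ _ fP _ ct _ _ _ widen) => //.
    by apply: (rep_mono fP) tk => x; rewrite /sing /pair_elt => ->.
  have sW : f (pair_elt ord0 ord0 (fun s _ _ => s = None) : A) (t \o g p (widen ord0)).
    apply: (@pair_elt_eq_on _ _ _ fP _ ct _ _ _ (l p)) => //.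
    by apply: (rep_mono fP) ft => x; rewrite /sing /pair_elt => ->.
  have [c fc] := @rep_cases _ _ _ fP q
    (fun c => pair_elt ord0 i1 (fun _ _ e => cls e.1 = c) : A) _
    (ct (g p (widen ord0))) (fun x => ex_intro _ _ erefl).
  exists (t, c); split=> //=.
  apply: (rep_mono fP) (rep_and fP (rep_and fP sK sW) fc) => x.
  by move=> [[sK' sW'] ec]; split.
have [tc tcP] := choice demand.
have [i [i' [ii' cE]]] : exists i i', i <> i' /\ (tc i).2 = (tc i').2.
  apply: contrapT => no; pose F (k : 'I_q.+1) := (tc k).2.
  have : injective F.
    move=> a b ab; apply: contrapT => nab; apply: no; exists a, b; split=> //.
    by move=> E; apply: nab; apply: val_inj.
  by move/leq_card; rewrite !card_ord ltnn.
have [ct ty ft fc] := tcP i; have [ct' ty' ft' fc'] := tcP i'.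
move: ct ty ft fc ct' ty' ft' fc'; rewrite -cE; set c := (tc i).2.
move: (tc i).1 (tc i').1 => t t' ct ty ft fc ct' ty' ft' fc'.
pose psi : nform A n := NAnd (NAtom (sing (wtyp i')) (l q')) (NAtom (Bc c) (g q' (widen ord0))).
(* In this order [w_i] is first overwritten by the copy of the point of [K_0], which restores [y];
   then the value at [p] of [t'] is put at [q'], by means of [sg]. *)
have : csat V f t (NEx p (NEx q' psi)).
  exists y; split=> //; split=> [a ap|]; first by rewrite ty.
  pose sg (b : 'I_n) := if b == q' then p else if b == p then widen ord0 else b.
  exists (t' \o sg); split; first by move=> k; apply: ct'.
  have sgw k : sg (widen k) = widen k by rewrite /sg (negPf (wq k)) (negPf (wp k)).
  have sgq : sg q' = p by rewrite /sg eqxx.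
  split.
    move=> a aq; rewrite /= /sg (negPf aq); case: eqVneq => [->|ap].
      by rewrite ty' // ypp.
    by rewrite ty'.
  split.
    change (f (sing (wtyp i')) (t' \o sg \o l q')).
    rewrite (_ : _ \o l q' = t' \o l p) //; apply: funext => k.
    by rewrite /l /=; case: eqP => _; rewrite ?sgq ?sgw.
  change (f (Bc c) (t' \o sg \o g q' (widen ord0))).
  rewrite (_ : _ \o g q' _ = t' \o g p (widen ord0)) //; apply: funext => k.
  by rewrite /g /=; case: eqP => _; rewrite ?sgq ?sgw.
(* In the other order the point at [q'] is chosen while [w_i] is still at [p]. As [psi] does not
   mention [x_p], the intermediate tuple [u] satisfies it already and contains both points. *)
move/(flat psi t p q' ct pq) => [u [cu [ut [v [cv [vu [fv1 fv2]]]]]]].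
have uq1 : f (sing (wtyp i')) (u \o l q').
  rewrite (_ : u \o l q' = (fun k => v (l q' k))) //; apply: funext => k /=.
  by rewrite vu // /l; case: ifP.
have uq2 : f (Bc c) (u \o g q' (widen ord0)).
  rewrite (_ : u \o g q' _ = (fun k => v (g q' (widen ord0) k))) //; apply: funext => k /=.
  by rewrite vu // /g; case: ifP.
have up1 : f (sing (wtyp i)) (u \o l p).
  rewrite (_ : u \o l p = t \o l p) //; apply: funext => k /=.
  by rewrite ut // /l; case: ifP.
have up2 : f (Bc c) (u \o g p (widen ord0)).
  rewrite (_ : u \o g p _ = t \o g p (widen ord0)) //; apply: funext => k /=.
  by rewrite ut // /g; case: ifP.
(* The two points have the different colours [lab i] and [lab i'] towards the point of [K_1]. *)
have upq : u p <> u q'.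
  move=> E; apply: (@rep_False _ _ _ fP (u \o l p)).
  have El : u \o l q' = u \o l p by apply: funext => k; rewrite /l /=; case: eqP.
  rewrite El in uq1; apply: (rep_mono fP) (rep_and fP up1 uq1) => x.
  rewrite /sing => -[-> E1]; apply: ii'; apply: lab_inj.
  by have /(congr1 (fun t => (ted t ord0 i1).1)) := E1.
pose G (w : 'I_n) (k : 'I_m) := if k == ord0 then p else if k == i1 then q' else w.
(* Some [j] is the index of the edge between the two points; the point of [K_j] then violates the
   rule. *)
have [j fj] := @rep_cases _ _ _ fP m
    (fun j => pair_elt ord0 i1 (fun _ _ e => e.2 = j) : A) _
    (cu (G (widen ord0))) (fun x => ex_intro _ _ erefl).
have clash (X Y : C -> Prop) :
    f (pair_elt ord0 i2 (Pw j X) : A) (u \o G (widen j)) ->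
    f (pair_elt i1 i2 (Pw j Y) : A) (u \o G (widen j)) ->
    (forall e e', X e -> Y e' -> conf j e e') -> False.
  move=> fX fY XY.
  have {}fj : f (pair_elt ord0 i1 (fun _ _ e => e.2 = j) : A) (u \o G (widen j)).
    by apply: (@pair_elt_eq_on _ _ _ fP _ cu) fj.
  have fd : f (fun x => ~ vtyp_diag ord0 i1 x : Prop) (u \o G (widen j)).
    by apply: (rep_not fP); [exact: cu|move/(rep_diag fP) => [_]].
  apply: (@rep_False _ _ _ fP (u \o G (widen j))).
  apply: (rep_mono fP) (rep_and fP (rep_and fP fX fY) (rep_and fP fj fd)) => x.
  rewrite /pair_elt => -[[[s0 s2 Xe] [s1 _ Ye]] [ej /negP d]].
  exact: ((svalP x).2 _ _ _ _ d s0 s1 s2 ej (XY _ _ Xe Ye)).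
have [j0|j0] := eqVneq j ord0.
  apply: (clash (fun e => cls e = c) (fun e => cls e = c)); rewrite ?j0.
  - by apply: (@pair_elt_02 _ _ _ fP _ cu) up2.
  - by apply: (@pair_elt_12 _ _ _ fP _ cu) uq2.
  - by move=> e e' ec ec'; apply: conf_cls; rewrite ec ec'.
apply: (clash (fun e => e = lab i) (fun e => e = lab i')).
- apply: (@pair_elt_02 _ _ _ fP _ cu j _ (l p)) => //; rewrite ?/l ?(negPf j0) //.
  apply: (rep_mono fP) up1 => x; rewrite /sing /pair_elt => -> /=.
  by rewrite (negPf j0).
- apply: (@pair_elt_12 _ _ _ fP _ cu j _ (l q')) => //; rewrite ?/l ?(negPf j0) //.
  apply: (rep_mono fP) uq1 => x; rewrite /sing /pair_elt => -> /=.
  by rewrite (negPf j0).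
- by move=> e e' -> ->; apply: conf_lab.
Qed.

End NotFlat.

(** * A total structure with infinitely many colour classes *)

Section TotalModel.
Variables (m' : nat) (C : eqType) (c0 : C).
Local Notation m := m'.+3.
Variable conf : 'I_m -> C -> C -> Prop.
Hypothesis conf_sym : forall j x y, conf j x y -> conf j y x.
Hypothesis conf_c0 : forall j x, j != ord0 -> ~ conf j c0 x.
Hypothesis conf_irr : forall j x, j != ord0 -> ~ conf j x x.
Hypothesis conf_trans : forall x y z,
  conf ord0 x y -> conf ord0 y z -> conf ord0 x z.
Variable psi : nat -> C -> C.
Hypothesis psi_inj : forall t l t' l',
  conf ord0 (psi t l) (psi t' l') -> t = t' /\ l = l'.

Local Notation point := (tree (option 'I_m) (C * 'I_m)%type m).
Local Notation edge0 := (edge0 m' c0).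
Let i1 : 'I_m := Ordinal (isT : 1 < m).

Definition lcol (x y : point) : C := (odflt edge0 (ldat x y)).1.

(** Testing parents of [x] or [y] is enough: a conflict with [j != ord0] needs listed edges, and if
    [z] lists both of them, its own soundness excludes the conflict. *)
Definition blocked (x y : point) (j : 'I_m) : Prop :=
  exists z, [/\ par x z \/ par y z, srt z = Some j & conf j (lcol x z) (lcol y z)].

Definition dflt_sort (x y : point) : 'I_m :=
  odflt ord0 [pick j | (j != ord0) && ~~ `[< blocked x y j >]].

(** Two points for which all nonzero indices are blocked by common neighbours have in particular
    conflicting colours towards one in [K_1], so this colour tells them apart. *)
Definition label (x : point) : C :=
  match x with
  | Leaf _ => c0
  | Node _ i p _ =>
      if [pick k | (k != i) && (srt (p k) == Some i1)] is Some k
      then lcol x (p k) else c0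
  end.

(** * Default colours towards points of [K_0] *)

Definition listed_cols (z : point) : seq C :=
  match z with
  | Leaf _ => [::]
  | Node _ _ _ d => [seq (d k).1 | k <- enum 'I_m]
  end.

(** By transitivity each colour of [L] conflicts with [psi t l] for at most one tag [t]. *)
Lemma fresh_tag (l : C) (L : seq C) :
  exists t, forall x, x \in L -> ~ conf ord0 (psi t l) x.
Proof.
suff [T TP] : exists T, forall t x, T <= t -> x \in L -> ~ conf ord0 (psi t l) x.
  by exists T => x; apply: TP.
elim: L => [|c L [T TP]]; first by exists 0.
have [[t0 t0c]|no] := EM (exists t, conf ord0 (psi t l) c).
  exists (maxn T t0.+1) => t x; rewrite geq_max => /andP[Tt t0t].
  rewrite inE => /orP[/eqP->|xL]; last exact: TP.
  move=> tc; have [E _] := psi_inj (conf_trans tc (conf_sym t0c)).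
  by rewrite E ltnn in t0t.
exists T => t x Tt; rewrite inE => /orP[/eqP->|xL]; last exact: TP.
by move=> tc; apply: no; exists t.
Qed.

Definition tag (l : C) (L : seq C) : nat := sval (cid (fresh_tag l L)).

(** An unlisted colour carries the label of [x], so different labels never conflict, and a tag that
    avoids the colours in [L], meant for the ancestors of [x], and those listed by [z]. *)
Definition own_col (z x : point) (L : seq C) : C :=
  if ldat x z is Some e then e.1
  else psi (tag (label x) (L ++ listed_cols z)) (label x).

(* The colours towards [z] of [x] and of all its ancestors, that of [x] first. *)
Fixpoint cols (z x : point) : seq C :=
  match x with
  | Leaf _ => [:: own_col z x [::]]
  | Node _ _ p _ =>
      let L := flatten [seq cols z (p k) | k <- enum 'I_m] in own_col z x L :: L
  end.

Definition col (x z : point) : C := head c0 (cols z x).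

Lemma colE x z : col x z = own_col z x (behead (cols z x)).
Proof. by case: x. Qed.

Lemma col_in x z : col x z \in cols z x.
Proof. by rewrite /col; case: x => *; rewrite /= mem_head. Qed.

Lemma cols_par x y z : par x y -> {subset cols z y <= behead (cols z x)}.
Proof.
case: x => // r i p d [k _ <-] c cy /=; apply/flattenP.
by exists (cols z (p k)) => //; apply/mapP; exists k; rewrite ?mem_enum.
Qed.

Lemma col_par x y z : par x y -> col y z \in behead (cols z x).
Proof. by move=> xy; apply: (cols_par xy); apply: col_in. Qed.

Lemma col_par2 x y w z : par x y -> par y w -> col w z \in behead (cols z x).
Proof.
move=> xy yw; apply: (cols_par xy); apply: mem_behead; exact: col_par.
Qed.

Lemma col_listed x z e : ldat x z = Some e -> col x z = e.1.
Proof. by rewrite colE /own_col => ->. Qed.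

Lemma col_unlisted x z : ldat x z = None -> exists t, col x z = psi t (label x).
Proof. by rewrite colE /own_col => ->; eexists. Qed.

Lemma col_fresh x z c : ldat x z = None ->
  c \in behead (cols z x) ++ listed_cols z -> ~ conf ord0 (col x z) c.
Proof.
by rewrite colE /own_col => ->; rewrite /tag; case: cid => t /= tP /tP.
Qed.

Lemma listed_colsP x z : par z x -> col x z \in listed_cols z.
Proof.
move=> zx; have /parP := zx; case E: (lst z x) => [e|//] _.
have -> : col x z = e.1 by apply: col_listed; rewrite ldat_sym ldat_par.
case: z {zx} E => //= r i p d; case: pickP => // k _ [<-].
by apply/mapP; exists k; rewrite ?mem_enum.
Qed.

Definition ed (x y : point) : C * 'I_m :=
  if ldat x y is Some e then e else
  match srt x, srt y with
  | None, None => (c0, dflt_sort x y)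
  | None, Some j => (if j == ord0 then col x y else c0, ord0)
  | Some j, None => (if j == ord0 then col y x else c0, ord0)
  | Some _, Some _ => edge0
  end.

Lemma blocked_sym x y j : blocked x y j -> blocked y x j.
Proof.
move=> [z [xy sz c]]; exists z; split=> //; last exact: conf_sym.
by case: xy; [right|left].
Qed.

Lemma dflt_sort_sym x y : dflt_sort x y = dflt_sort y x.
Proof.
rewrite /dflt_sort; congr odflt; apply: eq_pick => j /=; congr (_ && ~~ _).
by apply/asboolP/asboolP; apply: blocked_sym.
Qed.

Lemma ed_sym x y : ed x y = ed y x.
Proof.
rewrite /ed ldat_sym; case: (ldat y x) => //.
by case: (srt x) (srt y) => [i|] [j|] //; rewrite dflt_sort_sym.
Qed.

Lemma ed_lcol x z j : srt x = None -> srt z = Some j -> j != ord0 ->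
  (ed x z).1 = lcol x z.
Proof.
move=> sx sz /negPf j0; rewrite /ed /lcol; case: (ldat x z) => //=.
by rewrite sx sz j0.
Qed.

Lemma ed_col x z : srt x = None -> srt z = Some ord0 -> (ed x z).1 = col x z.
Proof.
move=> sx sz; rewrite /ed; case E: (ldat x z) => [e|]; first by rewrite (col_listed E).
by rewrite sx sz eqxx.
Qed.

(** * Soundness of points and the rule for arbitrary triples *)

Local Notation rule3 := (rule3 conf (@srt _ _ m) ed).

(** Only a point together with two of its parents is tested; the default edges take care of all
    other triples in [rule3_total]. *)
Definition sound (x : point) : Prop := forall y z, par x y -> par x z ->
  rule3 x y z /\ rule3 y z x.

Fixpoint hsound (x : point) : Prop := sound x /\
  match x with Leaf _ => True | Node _ _ p _ => forall k, hsound (p k) end.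

Lemma total_rule3_sym x y z : rule3 x y z -> rule3 y x z.
Proof.
move=> r j yx sy sx sz e cf; apply: (r j) => //; first exact: nesym.
  by rewrite ed_sym.
exact: conf_sym.
Qed.

Lemma lcol_listed x z y j : j != ord0 -> conf j (lcol x z) y -> par x z \/ par z x.
Proof.
move=> j0 c; apply/ldatP => E; move: c; rewrite /lcol E; exact: conf_c0.
Qed.

(* A point has at most [m - 1] parents, so once they realise all [m - 1] sorts
   other than [ord0] there is no room for any other parent. *)
Lemma critical_par x (zf : 'I_m -> point) :
  (forall j, j != ord0 -> par x (zf j) /\ srt (zf j) = Some j) ->
  forall w, par x w -> exists2 j, j != ord0 & w = zf j.
Proof.
case: x => [r|r i p d] H w //= [k ki <-].
have H' j : exists k, j != ord0 -> [/\ k != i, p k = zf j & srt (zf j) = Some j].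
  have [j0|j0] := eqVneq j ord0; first by exists i; rewrite j0.
  by have [[k' k'i E] sj] := H j j0; exists k'.
have [g gP] := choice H'.
pose G j := if j == ord0 then i else g j.
have GI : injective G.
  move=> a b; rewrite /G; case: eqVneq => [->|a0]; case: eqVneq => [->|b0] //.
  - by move=> E; have [] := gP b b0; rewrite -E eqxx.
  - by move=> E; have [] := gP a a0; rewrite E eqxx.
  - move=> E; have [_ pa sa] := gP a a0; have [_ pb sb] := gP b b0.
    by move: sa; rewrite -pa E pb sb => -[].
have [j E] := inj_onto GI k; move: E; rewrite /G; case: eqVneq => [_ E|j0 <-].
  by rewrite E eqxx in ki.
by exists j => //; have [] := gP j j0.
Qed.

Lemma critical_npar x (zf : 'I_m -> point) z :
  (forall j, j != ord0 -> par x (zf j) /\ srt (zf j) = Some j) ->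
  srt z = Some ord0 -> ~ par x z.
Proof.
move=> H sz /(critical_par H)[j j0 zE]; have [_] := H j j0.
by rewrite -zE sz => -[E]; rewrite E eqxx in j0.
Qed.

Lemma critical_label x (zf : 'I_m -> point) :
  (forall j, j != ord0 -> par x (zf j) /\ srt (zf j) = Some j) ->
  label x = lcol x (zf i1).
Proof.
move=> H; case: x H => [r|r i p d] H; first by have [] := H i1 isT.
rewrite /label; case: pickP => [k /andP[ki /eqP sk]|no].
  have [j j0 E] := critical_par H (par_Node _ _ _ ki).
  by have [_ sj] := H j j0; move: sk; rewrite E sj => -[->].
by have [[k ki E] sE] := H i1 isT; have := no k; rewrite ki E sE eqxx.
Qed.

(** When [j = ord0], an unlisted colour of [x] avoids that of its parent [y]; if [z] lists [x] but
    not [y], the colour of [y] avoids those listed by [z]. When [j != ord0], unlisted colours are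
    [c0], which never conflicts. *)
Lemma rule3_listed x y z : sound x -> sound z -> par x y -> rule3 x y z.
Proof.
move=> ox oz xy j ne sx sy sz E cf.
have [xz|nxz] := EM (par x z); first by apply: ((ox _ _ xy xz).1 j).
have [zx|nzx] := EM (par z x).
  have [zy|nzy] := EM (par z y); first by apply: ((oz _ _ zx zy).2 j).
  have nyz : ~ par y z.
    move=> /rank_par yz; have := ltn_trans (rank_par xy) (rank_par zx).
    by rewrite ltnNge ltnW.
  have U := ldatN nyz nzy.
  have [j0|j0] := eqVneq j ord0; last first.
    move: cf; rewrite (ed_lcol sy sz j0) /lcol U => /conf_sym; exact: conf_c0.
  rewrite {}j0 in sz cf; rewrite !ed_col // in cf.
  apply: (col_fresh U) (conf_sym cf).
  by rewrite mem_cat listed_colsP // orbT.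
have U := ldatN nxz nzx.
have [j0|j0] := eqVneq j ord0; last first.
  by move: cf; rewrite (ed_lcol sx sz j0) /lcol U; apply: conf_c0.
rewrite {}j0 in sz cf; rewrite !ed_col // in cf.
by apply: (col_fresh U) cf; rewrite mem_cat col_par.
Qed.

Lemma rule3_unlisted x y z : sound z -> ldat x y = None ->
  dflt_sort x y != ord0 -> rule3 x y z.
Proof.
move=> oz U d0 j ne sx sy sz; rewrite {1}/ed U sx sy /= => E cf.
have j0 : j != ord0 by rewrite -E.
have nb : ~ blocked x y j.
  move: E d0; rewrite /dflt_sort; case: pickP => [i /andP[_ /asboolP nb] /= <-//|_ /=].
  by move=> _; rewrite ?eqxx.
have cf' := cf; rewrite !(ed_lcol _ sz j0) // in cf'.
have [xz|nxz] := EM (par x z); first by apply: nb; exists z; split=> //; left.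
have [yz|nyz] := EM (par y z); first by apply: nb; exists z; split=> //; right.
have [//|zx] := lcol_listed j0 cf'; have [//|zy] := lcol_listed j0 (conf_sym cf').
apply: ((oz _ _ zx zy).2 j) => //; rewrite /ed U sx sy //=.
Qed.

(* All sorts but [ord0] are blocked for [x] and [y], by parents of [x]; then [y]
   has the same parents as [x] or is a grandparent of [x]. *)
Lemma rule3_critical x y z (zf : 'I_m -> point) : sound z ->
  (forall j, j != ord0 -> [/\ par x (zf j), srt (zf j) = Some j &
     conf j (lcol x (zf j)) (lcol y (zf j))]) ->
  (ed x y).2 = ord0 -> rule3 x y z.
Proof.
move=> oz H E j ne sx sy sz; rewrite E => j0; subst j => cf.
have cx j : j != ord0 -> par x (zf j) /\ srt (zf j) = Some j by move=> /H[].
have nxz := critical_npar cx sz.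
have yl j : j != ord0 -> par y (zf j) \/ par (zf j) y.
  by move=> j0; have [_ _ /conf_sym] := H j j0; apply: lcol_listed.
have cy : (forall j, j != ord0 -> ~ par (zf j) y) ->
    forall j, j != ord0 -> par y (zf j) /\ srt (zf j) = Some j.
  by move=> no j j0; have [yz|/no//] := yl j j0; have [_ s _] := H j j0.
have [zx|nzx] := EM (par z x).
  have [zy|nzy] := EM (par z y); first by apply: ((oz _ _ zx zy).2 ord0).
  have nyz : ~ par y z.
    move=> yz; apply: (critical_npar (cy _) sz yz) => j j0 /rank_par jy.
    have xj := rank_par (cx j j0).1.
    have := ltn_trans (ltn_trans jy xj) (ltn_trans (rank_par zx) (rank_par yz)).
    by rewrite ltnn.
  rewrite !ed_col // in cf; apply: (col_fresh (ldatN nyz nzy)) (conf_sym cf).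
  by rewrite mem_cat listed_colsP // orbT.
have U := ldatN nxz nzx; rewrite !ed_col // in cf.
have [[j [j0 jy]]|no] := EM (exists j, j != ord0 /\ par (zf j) y).
  by apply: (col_fresh U) cf; rewrite mem_cat (col_par2 _ (cx j j0).1 jy).
have {}cy := cy (fun j j0 jy => no (ex_intro _ j (conj j0 jy))).
have [zy|nzy] := EM (par z y).
  by apply: (col_fresh U) cf; rewrite mem_cat listed_colsP // orbT.
have nyz := critical_npar cy sz.
(* Neither colour is listed, so a conflict would force equal labels, whereas the labels are the
   conflicting colours towards [zf i1]. *)
have [t tE] := col_unlisted U; have [t' tE'] := col_unlisted (ldatN nyz nzy).
move: cf; rewrite tE tE' => /psi_inj[_].
rewrite (critical_label cx) (critical_label cy) => lE.
by have [_ _] := H i1 isT; rewrite lE; apply: conf_irr.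
Qed.

Lemma rule3_total x y z : sound x -> sound y -> sound z -> rule3 x y z.
Proof.
move=> ox oy oz; have [xy|nxy] := EM (par x y); first exact: rule3_listed.
have [yx|nyx] := EM (par y x); first by apply: total_rule3_sym; apply: rule3_listed.
have U := ldatN nxy nyx.
have [d0|d0] := eqVneq (dflt_sort x y) ord0; last exact: rule3_unlisted.
have [sx|sx] := eqVneq (srt x) None; last by move=> j _ E; rewrite E in sx.
have [sy|sy] := eqVneq (srt y) None; last by move=> j _ _ E; rewrite E in sy.
have E : (ed x y).2 = ord0 by rewrite /ed U sx sy.
have B j : exists w, j != ord0 -> [/\ par x w \/ par y w, srt w = Some j &
    conf j (lcol x w) (lcol y w)].
  have [->|j0] := eqVneq j ord0; first by exists x.
  suff [w] : blocked x y j by exists w.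
  move: d0; rewrite /dflt_sort; case: pickP => [i /andP[i0 _] /= E'|/(_ j)].
    by rewrite E' eqxx in i0.
  by rewrite j0 => /negbFE/asboolP.
have [zf zfP] := choice B.
have [xall|] := EM (forall j, j != ord0 -> par x (zf j)).
  by apply: (@rule3_critical _ _ _ zf) => // j j0; have [_ ? ?] := zfP j j0; split=> //; apply: xall.
(* The blocking points are then all parents of [y]: a parent of [x] that is not one of [y] would
   have [y] as a parent, while [zf j] is a parent of [y] and has [x] as a parent, a cycle of
   ranks. *)
move/existsNP=> [j /not_implyP[j0 nxj]].
apply: total_rule3_sym; apply: (@rule3_critical _ _ _ zf) => //; last by rewrite ed_sym.
move=> i i0; have [xyi si ci] := zfP i i0; split=> //; last exact: conf_sym.
case: xyi => // xi; apply: contrapT => nyi.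
have [|iy] := lcol_listed i0 (conf_sym ci); first by [].
have [xyj _ cj] := zfP j j0; case: xyj => // yj.
have [//|jx] := lcol_listed j0 cj.
have := ltn_trans (ltn_trans (rank_par iy) (rank_par xi))
                  (ltn_trans (rank_par jx) (rank_par yj)).
by rewrite ltnn.
Qed.

(** * The structure of hereditarily sound points *)

Definition tpoint := {x : point | hsound x}.
Definition tsort (x : tpoint) := srt (sval x).
Definition tedge (x y : tpoint) := ed (sval x) (sval y).
Local Notation ttyp := (typ_of c0 tsort tedge).

Lemma tedge_sym x y : tedge x y = tedge y x.
Proof. exact: ed_sym. Qed.

Lemma tpoint_eqP (x y : tpoint) : sval x = sval y -> x = y.
Proof. by case: x y => [x Sx] [y Sy] /= xy; apply: eq_exist. Qed.

Lemma tpoint_sound (x : tpoint) : sound (sval x).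
Proof. by case: x => -[r|r i p d] []. Qed.

Lemma valid_tpoint s : valid c0 conf (ttyp s).
Proof.
apply: valid_typ_of; first exact: tedge_sym.
move=> a b c j ne; apply: rule3_total; try exact: tpoint_sound.
by move=> E; apply: ne; apply: tpoint_eqP.
Qed.

(** The node listing the edges prescribed by [t] is sound because [t] obeys the rule; a coordinate
    that [t] identifies with another is copied instead. *)
Lemma extend_total s i t : valid c0 conf t ->
  agree_on (predC1 i) (ttyp s) t ->
  exists s', (forall a, a != i -> s' a = s a) /\ ttyp s' = t.
Proof.
move=> vt ag; have [hs he] := ag; have ct := vt.1.
have [[j [ji tij]]|no] := EM (exists j, i != j /\ teq t i j).
  exists (fun a => if a == i then s j else s a); split=> [a /negPf->//|].
  apply: (agree_off_uniq ji (congr_typ_of c0 _ tedge_sym _) ct) => //.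
  - split=> [a ai|a b ai bi] /=; rewrite (negPf ai); first exact: hs.
    by rewrite (negPf bi); apply: he.
  - by rewrite /= eqxx [j == i]eq_sym (negPf ji); apply/asboolP.
have nt a : a != i -> teq t i a = false.
  by move=> ai; apply/negP => H; apply: no; exists a; rewrite eq_sym.
pose p a := sval (s a).
have teqP a b : a != i -> b != i -> teq t a b <-> p a = p b.
  move=> ai bi; rewrite -(he a b ai bi).1 /=; split=> [/asboolP E|E].
    by rewrite /p E.
  by apply/asboolP; apply: tpoint_eqP.
have tedP a b : a != i -> b != i -> p a <> p b -> ed (p a) (p b) = ted t a b.
  move=> ai bi ne; rewrite -(he a b ai bi).2 /= asboolF //.
  by move=> E; apply: ne; rewrite /p E.
have sP a : a != i -> srt (p a) = tsrt t a by move=> ai; rewrite -hs.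
pose x : point := Node (tsrt t i) i p (ted t i).
have dP a b : a != i -> b != i -> p a = p b -> ted t i a = ted t i b.
  move=> ai bi /(teqP _ _ ai bi) E.
  by rewrite (ted_sym ct) (ted_eq ct _ E) (ted_sym ct).
have xe a : a != i -> ed x (p a) = ted t i a.
  by move=> ai; rewrite /ed ldat_par ?(lst_Node _ dP) //; apply: par_Node.
have sx : sound x.
  move=> _ _ [a ai <-] [b bi <-]; split=> j ne.
    rewrite !xe //= !sP // => si sa sb E.
    rewrite tedP //; last by move=> E'; move: sa; rewrite -sP // E' sP // sb.
    by apply: vt.2 => //; rewrite nt.
  rewrite !sP // => sa sb si; rewrite tedP // => E.
  rewrite ![ed _ x]ed_sym !xe // ![ted t i _](ted_sym ct).
  by apply: vt.2 => //; apply/negP => /(teqP _ _ ai bi).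
have hx : hsound x by split=> // k; apply: svalP.
exists (fun a => if a == i then exist _ x hx else s a); split=> [a /negPf->//|].
have xp a : exist _ x hx <> s a :> tpoint.
  by move=> /(congr1 sval) /=; apply: Node_neq.
apply: typ_eqP => [a|a b|a b] /=.
- by case: eqVneq => [->//|ai]; rewrite -hs.
- case: (eqVneq a i) => [->|ai]; case: (eqVneq b i) => [->|bi].
  + by rewrite (teq_refl ct); apply/asboolP.
  + by rewrite nt // asboolF.
  + by rewrite (teq_sym ct) nt // asboolF //; apply: nesym.
  + exact: (he a b ai bi).1.
- case: (eqVneq a i) => [->|ai]; case: (eqVneq b i) => [->|bi].
  + by rewrite asboolT // (ted_diag ct) // (teq_refl ct).
  + by rewrite asboolF // /tedge /= xe.
  + by rewrite asboolF; [rewrite tedge_sym /tedge /= xe // (ted_sym ct)|apply: nesym].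
  + exact: (he a b ai bi).2.
Qed.

Lemma realize_total t : valid c0 conf t -> exists s, ttyp s = t.
Proof.
move=> vt; have [|s i u _ vu ag|s [_ <-]] :=
  @realize _ _ _ _ tpoint tsort tedge (fun _ => True) _ _ t vt; last by exists s.
  move=> r; have h : hsound (Leaf _ _ r) by split.
  by exists (exist _ _ h).
by have [s' [_ E]] := extend_total vu ag; exists s'.
Qed.

Lemma total_model : exists (M : Type) (msrt : M -> option 'I_m) (med : M -> M -> C * 'I_m),
  let mtyp := typ_of c0 msrt med in
  [/\ forall s, valid c0 conf (mtyp s),
      forall s i t, valid c0 conf t -> agree_on (predC1 i) (mtyp s) t ->
        exists s', (forall a, a != i -> s' a = s a) /\ mtyp s' = t &
      forall t, valid c0 conf t -> exists s, mtyp s = t].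
Proof.
exists tpoint, tsort, tedge; split; first exact: valid_tpoint.
  by move=> s i t; apply: extend_total.
exact: realize_total.
Qed.

End TotalModel.

(** * The algebras at finite stages and the ultrapower of the colours *)

Section Colours.
Variables (m' n : nat).
Local Notation m := m'.+3.

(** The summand [4 ^ r] makes room for the codes in [psi], the other one for [n] fresh colours
    besides [n * n + n] given ones. *)
Definition ncls (r : nat) : nat := 4 ^ r + (n * n + n + n).

Definition nconf (r : nat) (j : 'I_m) (x y : nat) : Prop :=
  if j == ord0 then minn x (ncls r) = minn y (ncls r)
  else [/\ x <> 0, y <> 0 & x <> y].

Lemma nconf_sym r j x y : nconf r j x y -> nconf r j y x.
Proof. by rewrite /nconf; case: ifP => _ // [? ? ?]; split=> //; apply: nesym. Qed.

(** For [j != ord0] the colour 0 serves throughout. Otherwise [L] leaves at least [n] of the colours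
    below [ncls r], each of which is a class by itself. *)
Lemma nconf_fresh r j (L : seq nat) : size L <= n * n + n ->
  exists F : 'I_n -> nat, (forall a b, a <> b -> ~ nconf r j (F a) (F b)) /\
    (forall a x, x \in L -> ~ nconf r j (F a) x).
Proof.
move=> szL; have [j0|j0] := eqVneq j ord0; last first.
  by exists (fun _ => 0); rewrite /nconf (negPf j0); split=> [a b _|a x _] [].
set s := [seq x <- iota 0 (ncls r) | x \notin L].
have szs : n <= size s.
  have := count_predC (mem L) (iota 0 (ncls r)); rewrite size_iota => E.
  have le : count (mem L) (iota 0 (ncls r)) <= n * n + n.
    rewrite (leq_trans _ szL) // -size_filter uniq_leq_size //.
      by rewrite filter_uniq // iota_uniq.
    by move=> x; rewrite mem_filter => /andP[].
  rewrite size_filter -(leq_add2l (count (mem L) (iota 0 (ncls r)))) E.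
  by rewrite (leq_trans (leq_add le (leqnn n))) // /ncls leq_addl.
have sP (a : 'I_n) : nth 0 s a < ncls r /\ nth 0 s a \notin L.
  have /(mem_nth 0) : a < size s by apply: leq_trans szs.
  by rewrite mem_filter mem_iota add0n => /andP[aL /andP[_ al]].
exists (fun a : 'I_n => nth 0 s a); rewrite /nconf j0 eqxx.
split=> [a b ab|a x xL].
  have [al _] := sP a; have [bl _] := sP b.
  rewrite (minn_idPl (ltnW al)) (minn_idPl (ltnW bl)) => /eqP.
  rewrite nth_uniq ?filter_uniq ?iota_uniq //; try exact: leq_trans szs.
  by move=> /eqP E; apply: ab; apply: val_inj.
have [al anL] := sP a; rewrite (minn_idPl (ltnW al)) => E.
move: al anL; rewrite E gtn_min ltnn orbF => xl.
by rewrite (minn_idPl (ltnW xl)) xL.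
Qed.

Hypothesis le_mn : m <= n.

Definition stage (r : nat) : CA m :=
  typ_algebra 0 (@nconf_sym r) (@nconf_fresh r) le_mn.

Lemma stage_square r : has_n_square_rep (stage r) n.
Proof. exact: typ_algebra_square. Qed.

Lemma stage_not_flat r : m + 2 <= n -> ~ has_n_flat_rep (stage r) n.
Proof.
(* The last of the [ncls r + 1] classes consists of all colours from [ncls r] on. The labels are
   successors because 0 conflicts with nothing for [j != ord0]. *)
move=> le2; apply: (@typ_algebra_not_flat _ _ _ _ _ _ _ _ le2 (ncls r).+1
  (fun x => inord (minn x (ncls r))) succn).
- move=> x y /(congr1 val); rewrite /nconf eqxx.
  by rewrite /= !inordK // ltnS geq_minr.
- move=> j i i' j0 ii'; rewrite /nconf (negPf j0); split=> //.
  by move=> [].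
- by move=> a b [].
Qed.

End Colours.

(** * Nonprincipal ultrafilters on [nat] *)

Record nat_ultrafilter (D : (nat -> Prop) -> Prop) : Prop := NatUltrafilter {
  ufS : forall P Q : nat -> Prop, (forall r, P r -> Q r) -> D P -> D Q;
  ufI : forall P Q : nat -> Prop, D P -> D Q -> D (fun r => P r /\ Q r);
  uf0 : ~ D (fun _ => False);
  ufC : forall P : nat -> Prop, D P \/ D (fun r => ~ P r);
  uf_ge : forall k, D (fun r => k <= r) }.

Lemma nat_ultrafilter_ex : exists D, nat_ultrafilter D.
Proof.
have [D [DU oD]] := ultraFilterLemma eventually_filter.
have DF : ProperFilter D := ultra_proper.
exists D; split.
- by move=> P Q PQ; apply: filterS.
- by move=> P Q; apply: filterI.
- exact: filter_not_empty.
- by move=> P; apply: in_ultra_setVsetC.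
- by move=> k; apply: oD; exists k.
Qed.

Section Ultra.
Variable D : (nat -> Prop) -> Prop.
Hypothesis DU : nat_ultrafilter D.

Lemma ufT (P : nat -> Prop) : (forall r, P r) -> D P.
Proof. by move=> PT; apply: ufS (uf_ge DU 0). Qed.

Lemma uf_ex (P : nat -> Prop) : D P -> exists r, P r.
Proof.
by move=> DP; apply: contrapT => /forallNP no; apply: (uf0 DU); apply: ufS DP.
Qed.

Lemma ufN (P : nat -> Prop) : ~ D P <-> D (fun r => ~ P r).
Proof.
split=> [nP|DN DP]; first by have [] := ufC DU P.
by have [r []] := uf_ex (ufI DU DP DN).
Qed.

Lemma ufU (P Q : nat -> Prop) : D (fun r => P r \/ Q r) -> D P \/ D Q.
Proof.
move=> DPQ; have [DP|/ufN nP] := EM (D P); first by left.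
by right; apply: ufS DU _ _ _ (ufI DU nP DPQ) => r [? []].
Qed.

Lemma uf_forall (T : finType) (P : T -> nat -> Prop) :
  (forall a, D (P a)) -> D (fun r => forall a, P a r).
Proof.
move=> DP; suff : D (fun r => forall a, a \in enum T -> P a r).
  by apply: ufS DU _ _ _ => r H a; apply: H; rewrite mem_enum.
elim: (enum T) => [|b s IH]; first exact: ufT.
apply: ufS DU _ _ _ (ufI DU (DP b) IH) => r [Pb H] a.
by rewrite inE => /orP[/eqP->//|/H].
Qed.

Lemma uf_exists (T : finType) (P : T -> nat -> Prop) :
  D (fun r => exists a, P a r) -> exists a, D (P a).
Proof.
move=> DP; apply: contrapT => /forallNP no.
have /uf_forall nP a : D (fun r => ~ P a r) by apply/ufN.
by have [r [[a Pa] nPr]] := uf_ex (ufI DU DP nP); apply: (nPr a).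
Qed.

Lemma uf_value (T : finType) (g : nat -> T) : exists v, D (fun r => g r = v).
Proof. by apply: uf_exists; apply: ufT => r; exists (g r). Qed.

(* [upower] is the ultrapower of [nat]: choosing a canonical sequence in each class
   makes equality modulo [D] Leibniz equality. *)
Definition canon (f : nat -> nat) : {classic nat -> nat} :=
  xget ((fun _ => 0) : {classic nat -> nat})
    (fun g : {classic nat -> nat} => D (fun r => g r = f r)).

Lemma canonP f : D (fun r => canon f r = f r).
Proof.
rewrite /canon; apply: (@xgetPex {classic nat -> nat} _
  (fun g : {classic nat -> nat} => D (fun r => g r = f r))).
by exists f; apply: ufT.
Qed.

Lemma canon_eq f g : D (fun r => f r = g r) -> canon f = canon g.
Proof.
move=> fg; rewrite /canon; congr xget; apply: funext => h; apply: propext.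
by split=> H; apply: ufS DU _ _ _ (ufI DU H fg) => r [-> ->].
Qed.

Definition upower := {classic {f : nat -> nat | canon f = f}}.

Definition uval (c : upower) : nat -> nat := sval (c : {f : nat -> nat | canon f = f}).

Definition umk (f : nat -> nat) : upower :=
  exist (fun f => canon f = f) (canon f) (canon_eq (canonP f)).

Lemma umkP f : D (fun r => uval (umk f) r = f r).
Proof. exact: canonP. Qed.

Lemma upower_eqP (c c' : upower) : D (fun r => uval c r = uval c' r) -> c = c'.
Proof.
case: c c' => [f fE] [g gE]; rewrite /uval /= => fg; apply: eq_exist.
by rewrite -fE -gE; apply: canon_eq.
Qed.

(** * Injecting tags and labels into the colour classes of the ultrapower *)

Fixpoint prefix_code (b : nat -> bool) (r : nat) : nat :=
  if r is r'.+1 then (prefix_code b r').*2 + b r' else 0.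

Lemma prefix_code_lt b r : prefix_code b r < 2 ^ r.
Proof.
elim: r => //= r IH; rewrite expnS mul2n.
case: (b r); rewrite ?addn1 ?addn0 ?ltn_double // -doubleS leq_double //.
Qed.

Lemma prefix_code_inj b b' r : prefix_code b r = prefix_code b' r ->
  forall q, q < r -> b q = b' q.
Proof.
elim: r => //= r IH E q; have E1 : b r = b' r.
  by have := congr1 odd E; rewrite !oddD !odd_double /= !oddb.
rewrite ltnS leq_eqVlt => /orP[/eqP->//|]; apply: IH.
by move/eqP: E; rewrite E1 eqn_add2r => /eqP/double_inj.
Qed.

Definition graph_bit (f : nat -> nat) (q : nat) : bool :=
  if unpickle q is Some (i, v) then f i == v else false.

(** Stage [r] records the tag and the first [r] bits of the graph of the label. Distinct labels
    differ at some bit, hence in all codes of later stages. *)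
Definition psi (t : nat) (l : upower) : upower :=
  umk (fun r => t * 2 ^ r + prefix_code (graph_bit (uval l)) r).

Variables (m' n : nat).
Local Notation m := m'.+3.

Definition uconf (j : 'I_m) (x y : upower) : Prop :=
  D (fun r => nconf n r j (uval x r) (uval y r)).

Definition u0 : upower := umk (fun _ => 0).

Lemma uconf_sym j x y : uconf j x y -> uconf j y x.
Proof. by apply: ufS => // r; apply: nconf_sym. Qed.

Lemma uconf_u0 j x : j != ord0 -> ~ uconf j u0 x.
Proof.
move=> /negPf j0; rewrite /uconf /nconf j0 => H.
by have [r [[]]] := uf_ex (ufI DU H (umkP (fun _ => 0))).
Qed.

Lemma uconf_irr j x : j != ord0 -> ~ uconf j x x.
Proof. by move=> /negPf j0; rewrite /uconf /nconf j0 => /uf_ex[r []]. Qed.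

Lemma uconf_trans x y z : uconf ord0 x y -> uconf ord0 y z -> uconf ord0 x z.
Proof.
rewrite /uconf /nconf eqxx => xy yz.
by apply: ufS DU _ _ _ (ufI DU xy yz) => r [-> ->].
Qed.

Lemma psi_inj t l t' l' : uconf ord0 (psi t l) (psi t' l') -> t = t' /\ l = l'.
Proof.
rewrite /uconf /nconf eqxx => H.
(* Since [u < 2 ^ r], the code is below [(u + 1) * 2 ^ r <= 4 ^ r], so the truncation in [nconf]
   does not affect it. *)
have small (b : nat -> bool) u r : u <= r -> u * 2 ^ r + prefix_code b r < ncls n r.
  move=> ur; rewrite /ncls (@leq_trans (4 ^ r)) ?leq_addr //.
  rewrite (@leq_trans (u.+1 * 2 ^ r)) //.
    by rewrite mulSn addnC ltn_add2r prefix_code_lt.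
  rewrite (_ : 4 = 2 * 2) // expnMn leq_mul2r.
  by rewrite (leq_ltn_trans ur) ?orbT // ltn_expl.
pose code u (c : upower) r := u * 2 ^ r + prefix_code (graph_bit (uval c)) r.
have {}H : D (fun r => t = t' /\
    prefix_code (graph_bit (uval l)) r = prefix_code (graph_bit (uval l')) r).
  apply: ufS DU _ _ _ (ufI DU (ufI DU H (uf_ge DU (maxn t t')))
    (ufI DU (umkP (code t l)) (umkP (code t' l')))) => r [[+ +] [E1 E2]].
  rewrite /psi -/(code t l) -/(code t' l') E1 E2 geq_max => E /andP[tr t'r].
  move: E; rewrite !(minn_idPl (ltnW (small _ _ _ _))) // => E.
  have p2 : 0 < 2 ^ r by rewrite expn_gt0.
  have := congr1 (divn^~ (2 ^ r)) E; have := congr1 (modn^~ (2 ^ r)) E.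
  by rewrite /= !modnMDl !modn_small ?prefix_code_lt // !divnMDl // !divn_small
    ?prefix_code_lt // !addn0.
have [r [tt' _]] := uf_ex H; split=> //; apply: upower_eqP; apply: ufT => i.
(* Bit [k] says that the label takes its value [uval l i] at [i]; a prefix of length [k + 1]
   contains it. *)
pose k := pickle (i, uval l i).
have [r' [[_ E] kr]] := uf_ex (ufI DU H (uf_ge DU k.+1)).
have := prefix_code_inj E kr; rewrite /graph_bit /k pickleK eqxx.
by move=> /esym/eqP.
Qed.

End Ultra.

(** * The ultraproduct *)

Section SetAlgebraRep.
Variables (m : nat) (M : Type) (S : full_set_algebra m M -> Prop).
Variables (Sadd : forall x y, S x -> S y -> S (ca_add x y))
  (Smul : forall x y, S x -> S y -> S (ca_mul x y))
  (Scompl : forall x, S x -> S (ca_compl x))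
  (Szero : S (ca_zero (full_set_algebra m M)))
  (Sone : S (ca_one (full_set_algebra m M)))
  (Sc : forall i x, S x -> S (ca_c i x))
  (Sd : forall i j, S (ca_d (full_set_algebra m M) i j)).
Local Notation U := (sub_algebra Sadd Smul Scompl Szero Sone Sc Sd).

(** All tuples are cliques, so the guarded quantifiers are the ordinary ones and commute. *)
Lemma set_algebra_flat n : 0 < m -> has_n_flat_rep U n.
Proof.
move=> m0; exists M, (fun _ => True), (fun X s => sval X s); split.
  split; [|split; [|split; [|split; [|split; [|split; [|split; [|split; [|split]]]]]]]] => //=.
  - by move=> x; exists (fun _ => x); split=> //; exists (Ordinal m0).
  - by move=> X s; split=> [nX|[_ nX]].
  - by move=> _ [].
  - move=> i X s; split=> [[t [st Xt]]|[_ [t [Xt ts]]]].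
      by split=> //; exists t; split=> // j ji; rewrite st.
    by exists t; split=> // j ji; rewrite ts.
  - by move=> i j s; split=> [|[]].
  - by move=> X Y XY; apply: (@sub_eqP m (full_set_algebra m M) S); apply: pred_eqP.
split.
  move=> s X i l _ lI [t [st Xt]].
  exists (fun b => if b == l i then t i else s b); split=> //.
  split=> [j /negPf-> //|].
  rewrite [X in sval _ X](_ : _ = t) //; apply: funext => k.
  by rewrite inj_eq //; case: eqVneq => [->//|ki]; rewrite -st.
have H phi (s : 'I_n -> M) i j : i != j ->
    csat (A := U) (fun _ => True) (fun X s => sval X s) s (NEx i (NEx j phi)) ->
    csat (A := U) (fun _ => True) (fun X s => sval X s) s (NEx j (NEx i phi)).
  move=> ij [t [_ [ts [u [_ [ut Hu]]]]]].
  exists (fun k => if k == j then u j else s k); split=> //; split=> [k /negPf->//|].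
  exists u; split=> //; split=> // k ki; case: eqVneq => [->//|kj].
  by rewrite ut // ts.
by move=> phi s i j _ ij; split; apply: H => //; rewrite eq_sym.
Qed.

Lemma flat_square (A : CA m) n : has_n_flat_rep A n -> has_n_square_rep A n.
Proof. by move=> [M' [V [f [fP [sq _]]]]]; exists M', V, f. Qed.

End SetAlgebraRep.

Section Ultraproduct.
Variable D : (nat -> Prop) -> Prop.
Hypothesis DU : nat_ultrafilter D.
Variables (m' n : nat).
Local Notation m := m'.+3.
Hypothesis le_mn : m <= n.

Local Notation C := (upower D).
Local Notation zero := (u0 DU).
Local Notation uconf := (@uconf D m' n).
Local Notation A := (stage le_mn).
Local Notation rvalid r := (valid 0 (@nconf m' n r)).


Variables (M : Type) (msrt : M -> option 'I_m) (med : M -> M -> C * 'I_m).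
Local Notation mtyp := (typ_of zero msrt med).
Hypothesis mvalid : forall s, valid zero uconf (mtyp s).
Hypothesis mextend : forall s i t, valid zero uconf t ->
  agree_on (predC1 i) (mtyp s) t ->
  exists s', (forall a, a != i -> s' a = s a) /\ mtyp s' = t.
Hypothesis mrealize : forall t, valid zero uconf t -> exists s, mtyp s = t.

Definition teval (r : nat) (t : typ m' C) : typ m' nat :=
  Typ (teq t) (tsrt t) (fun a b => (uval (ted t a b).1 r, (ted t a b).2)).

Lemma teval_valid t : valid zero uconf t -> D (fun r => rvalid r (teval r t)).
Proof.
move=> [ct rt].
have rD : D (fun r => forall p : 'I_m * 'I_m * 'I_m,
    let: (a, b, c) := p in forall j, ~~ teq t a b ->
    tsrt t a = None -> tsrt t b = None -> tsrt t c = Some j ->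
    (ted t a b).2 = j -> ~ nconf n r j (uval (ted t a c).1 r) (uval (ted t b c).1 r)).
  apply: uf_forall => // -[[a b] c].
  have [[j [ab sa sb sc E]]|no] := EM (exists j, [/\ ~~ teq t a b,
      tsrt t a = None, tsrt t b = None, tsrt t c = Some j & (ted t a b).2 = j]).
    have /(ufN DU) := rt a b c j ab sa sb sc E.
    by apply: ufS DU _ _ _ => r nc j' _ _ _; rewrite sc => -[<-].
  by apply: ufT DU _ _ => r j ab sa sb sc E; case: no; exists j.
apply: ufS DU _ _ _ (ufI DU rD (umkP DU (fun _ => 0))) => r [rr z0].
split; last by move=> a b c j; apply: (rr (a, b, c)).
split=> /=.
- exact: teq_refl ct.
- exact: teq_sym ct.
- exact: teq_trans ct.
- exact: tsrt_eq ct.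
- by move=> a b c /(ted_eq ct)->.
- by move=> a b; rewrite (ted_sym ct).
- by move=> a b /(ted_diag ct)->; apply: (congr1 (fun x => (x, ord0)) z0).
Qed.

(** Equalities, sorts and indices do not depend on the stage and can be checked at a single one;
    colours are compared modulo [D]. *)
Lemma valid_teval t : D (fun r => rvalid r (teval r t)) -> valid zero uconf t.
Proof.
move=> H; have [r0 [c0 _]] := uf_ex DU H; split; last first.
  move=> a b c j ab sa sb sc E cf.
  by have [r [[_ rr]]] := uf_ex DU (ufI DU H cf); apply: rr.
split.
- exact: teq_refl c0.
- exact: teq_sym c0.
- exact: teq_trans c0.
- exact: tsrt_eq c0.
- move=> a b c ab; apply/eqP/andP; split; apply/eqP.
    apply: upower_eqP => //; apply: ufS DU _ _ _ H => r [cr _].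
    by have := ted_eq cr c ab => -[].
  by have := ted_eq c0 c ab => -[].
- move=> a b; apply/eqP/andP; split; apply/eqP.
    apply: upower_eqP => //; apply: ufS DU _ _ _ H => r [cr _].
    by have := ted_sym cr a b => -[].
  by have := ted_sym c0 a b => -[].
- move=> a b ab; apply/eqP/andP; split; apply/eqP.
    apply: upower_eqP => //.
    apply: ufS DU _ _ _ (ufI DU H (umkP DU (fun _ => 0))) => r [[cr _] z0].
    by have := ted_diag cr ab => -[-> _]; apply/esym: z0.
  by have := ted_diag c0 ab => -[].
Qed.

(** Equalities, sorts and indices take finitely many values, so each is constant on a set in [D];
    the colours are collected into elements of the ultrapower. *)
Lemma glue (sg : nat -> typ m' nat) : D (fun r => rvalid r (sg r)) ->
  exists t, valid zero uconf t /\ D (fun r => teval r t = sg r).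
Proof.
move=> vsg.
have [e eP] := choice (fun p : 'I_m * 'I_m => uf_value DU (fun r => teq (sg r) p.1 p.2)).
have [so soP] := choice (fun a : 'I_m => uf_value DU (fun r => tsrt (sg r) a)).
have [E EP] := choice (fun p : 'I_m * 'I_m => uf_value DU (fun r => (ted (sg r) p.1 p.2).2)).
pose c a b := umk DU (fun r => (ted (sg r) a b).1).
pose t := Typ (fun a b => e (a, b)) so (fun a b => (c a b, E (a, b))).
have tD : D (fun r => teval r t = sg r).
  have cD := uf_forall DU (fun p : 'I_m * 'I_m =>
    umkP DU (fun r => (ted (sg r) p.1 p.2).1)).
  apply: ufS DU _ _ _ (ufI DU (ufI DU (uf_forall DU eP) (uf_forall DU soP))
    (ufI DU (uf_forall DU EP) cD)) => r [[er sr] [Er cr]].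
  apply: typ_eqP => [a|a b|a b] /=.
  - by rewrite sr.
  - by rewrite (er (a, b)).
  - by rewrite [RHS]surjective_pairing; congr pair; [exact: (cr (a, b))|rewrite -(Er (a, b))].
exists t; split=> //; apply: valid_teval.
by apply: ufS DU _ _ _ (ufI DU vsg tD) => r [? ->].
Qed.

(** * The embedding of the ultraproduct into a full set algebra *)

Definition useq := forall r, A r.

Definition uset (a : useq) (s : 'I_m -> M) : Prop :=
  D (fun r => exists v : rvalid r (teval r (mtyp s)), a r (exist _ _ v)).

Lemma stage_ext r (X : A r) (x : vtyp 0 (@nconf m' n r)) t (v : rvalid r t) :
  sval x = t -> X x -> X (exist _ _ v).
Proof. by move=> E Xx; rewrite (_ : exist _ _ v = x) //; apply: vtyp_eqP. Qed.

Lemma uset_add (a b : useq) : uset (fun r => ca_add (a r) (b r)) =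
  ca_add (uset a : full_set_algebra m M) (uset b).
Proof.
apply: pred_eqP => s; split=> [H|].
  by apply: (ufU DU); apply: ufS DU _ _ _ H => r [v [|]]; [left|right]; exists v.
by case; apply: ufS DU _ _ _ => r [v av]; exists v; [left|right].
Qed.

Lemma uset_mul (a b : useq) : uset (fun r => ca_mul (a r) (b r)) =
  ca_mul (uset a : full_set_algebra m M) (uset b).
Proof.
apply: pred_eqP => s; split=> [H|[Ha Hb]].
  by split; apply: ufS DU _ _ _ H => r [v []]; exists v.
apply: ufS DU _ _ _ (ufI DU Ha Hb) => r [[v av] [v' bv]]; exists v; split=> //.
exact: stage_ext bv.
Qed.

Lemma uset_compl (a : useq) : uset (fun r => ca_compl (a r)) =
  ca_compl (uset a : full_set_algebra m M).
Proof.
apply: pred_eqP => s; split=> [H H'|H].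
  have [r [[v nav] [v' av]]] := uf_ex DU (ufI DU H H').
  by apply: nav; apply: stage_ext av.
have /(ufN DU) {}H : ~ D (fun r => exists v : rvalid r (teval r (mtyp s)), a r (exist _ _ v)) by [].
apply: ufS DU _ _ _ (ufI DU H (teval_valid (mvalid s))) => r [nv v].
by exists v => av; apply: nv; exists v.
Qed.

Lemma uset_zero : uset (fun r => ca_zero (A r)) = ca_zero (full_set_algebra m M).
Proof. by apply: pred_eqP => s; split=> // H; have [r []] := uf_ex DU H. Qed.

Lemma uset_one : uset (fun r => ca_one (A r)) = ca_one (full_set_algebra m M).
Proof.
apply: pred_eqP => s; split=> // _.
by apply: ufS DU _ _ _ (teval_valid (mvalid s)) => r v; exists v.
Qed.

Lemma uset_diag i j :
  uset (fun r => ca_d (A r) i j) = ca_d (full_set_algebra m M) i j.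
Proof.
apply: pred_eqP => s; split=> [H|sij].
  by have [r [v /asboolP]] := uf_ex DU H.
apply: ufS DU _ _ _ (teval_valid (mvalid s)) => r v; exists v.
by apply/asboolP.
Qed.

Lemma uset_realize (a : useq) (sg : forall r, vtyp 0 (@nconf m' n r)) :
  D (fun r => a r (sg r)) -> forall t, D (fun r => teval r t = sval (sg r)) ->
  forall s, mtyp s = t -> uset a s.
Proof.
move=> Ha t tsg s sE; apply: ufS DU _ _ _ (ufI DU Ha tsg) => r [ar E].
have v : rvalid r (teval r (mtyp s)) by rewrite sE E; apply: svalP.
by exists v; apply: stage_ext ar; rewrite sE.
Qed.

Lemma vtyp_inhabited r : exists x : vtyp 0 (@nconf m' n r), True.
Proof. by exists (exist _ _ (valid_ktyp 0 (@nconf m' n r))). Qed.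

(** Witnessing types chosen stage by stage are glued into one type over the ultrapower, which
    [mextend] realises by changing the point at [i]. *)
Lemma uset_cyl i (a : useq) : uset (fun r => ca_c i (a r)) =
  ca_c i (uset a : full_set_algebra m M).
Proof.
apply: pred_eqP => s; split=> [H|[t [st Ht]]]; last first.
  apply: ufS DU _ _ _ (ufI DU (teval_valid (mvalid s)) Ht) => r [v [v' av]].
  exists v, (exist _ _ v'); split=> //.
  by split=> [b /= /st->//|b c /= /st-> /st->].
(* At stages without a witness an arbitrary type is taken. *)
have H' r : exists x : vtyp 0 (@nconf m' n r),
    (exists v : rvalid r (teval r (mtyp s)), ca_c i (a r) (exist _ _ v)) ->
    agree_on (predC1 i) (teval r (mtyp s)) (sval x) /\ a r x.
  have [[v [x [vx ax]]]|no] := EM (exists v : rvalid r (teval r (mtyp s)),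
      ca_c i (a r) (exist _ _ v)); first by exists x.
  by have [x _] := vtyp_inhabited r; exists x => /no.
pose sg r := sval (cid (H' r)).
have sgP : D (fun r => agree_on (predC1 i) (teval r (mtyp s)) (sval (sg r)) /\ a r (sg r)).
  by apply: ufS DU _ _ _ H => r; apply: (svalP (cid (H' r))).
have [|t [vt tsg]] := glue (sg := fun r => sval (sg r)).
  by apply: ufT => // r; apply: svalP.
have agD : D (fun r => agree_on (predC1 i) (teval r (mtyp s)) (teval r t)).
  by apply: ufS DU _ _ _ (ufI DU sgP tsg) => r [[ag _] ->].
have [r0 ag0] := uf_ex DU agD.
have [|s' [s's sE]] := @mextend s i t vt.
  split=> [b bi|b c bi ci]; first exact: ag0.1.
  have [E1 E2] := ag0.2 b c bi ci; split=> //.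
  apply/eqP/andP; split; apply/eqP; last by move: E2 => -[].
  apply: upower_eqP => //; apply: ufS DU _ _ _ agD => r [_ /(_ b c bi ci)[_]].
  by case.
exists s'; split; first by move=> b bi; rewrite s's.
apply: (uset_realize (sg := sg)) tsg _ sE.
by apply: ufS DU _ _ _ sgP => r [].
Qed.

(** Otherwise counterexamples at the single stages glue to a type, and a tuple of [M] realising it
    separates the two sets. *)
Lemma uset_sub (a b : useq) : uset a = uset b -> D (fun r => forall x, a r x -> b r x).
Proof.
move=> ab; apply: contrapT => /(ufN DU) H.
have H' r : exists x : vtyp 0 (@nconf m' n r),
    ~ (forall x, a r x -> b r x) -> a r x /\ ~ b r x.
  have [[x xP]|no] := EM (exists x, a r x /\ ~ b r x); first by exists x.
  have [x _] := vtyp_inhabited r; exists x => -[y ay].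
  by apply: contrapT => nb; apply: no; exists y.
pose sg r := sval (cid (H' r)).
have sgP : D (fun r => a r (sg r) /\ ~ b r (sg r)).
  by apply: ufS DU _ _ _ H => r; apply: (svalP (cid (H' r))).
have [|t [vt tsg]] := glue (sg := fun r => sval (sg r)).
  by apply: ufT => // r; apply: svalP.
have [s sE] := mrealize vt.
have Ha : uset a s.
  by apply: (uset_realize (sg := sg)) tsg _ sE; apply: ufS DU _ _ _ sgP => r [].
have Hb : uset (fun r => ca_compl (b r)) s.
  by apply: (uset_realize (sg := sg)) tsg _ sE; apply: ufS DU _ _ _ sgP => r [].
by rewrite uset_compl in Hb; apply: Hb; rewrite -ab.
Qed.

Lemma uset_inj (a b : useq) : uset a = uset b <-> D (fun r => a r = b r).
Proof.
split=> [ab|ab].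
  apply: ufS DU _ _ _ (ufI DU (uset_sub ab) (uset_sub (esym ab))) => r [H1 H2].
  by apply: pred_eqP => x; split; [apply: H1|apply: H2].
by apply: pred_eqP => s; split=> H; apply: ufS DU _ _ _ (ufI DU H ab) => r [[v av] E];
  exists v; rewrite ?E // -E.
Qed.

Definition is_uset (X : full_set_algebra m M) : Prop := exists a, X = uset a.

Lemma is_uset_add X Y : is_uset X -> is_uset Y -> is_uset (ca_add X Y).
Proof. by move=> [a ->] [b ->]; eexists; rewrite -uset_add. Qed.

Lemma is_uset_mul X Y : is_uset X -> is_uset Y -> is_uset (ca_mul X Y).
Proof. by move=> [a ->] [b ->]; eexists; rewrite -uset_mul. Qed.

Lemma is_uset_compl X : is_uset X -> is_uset (ca_compl X).
Proof. by move=> [a ->]; eexists; rewrite -uset_compl. Qed.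

Lemma is_uset_zero : is_uset (ca_zero (full_set_algebra m M)).
Proof. by eexists; rewrite -uset_zero. Qed.

Lemma is_uset_one : is_uset (ca_one (full_set_algebra m M)).
Proof. by eexists; rewrite -uset_one. Qed.

Lemma is_uset_cyl i X : is_uset X -> is_uset (ca_c i X).
Proof. by move=> [a ->]; eexists; rewrite -uset_cyl. Qed.

Lemma is_uset_diag i j : is_uset (ca_d (full_set_algebra m M) i j).
Proof. by eexists; rewrite -uset_diag. Qed.

(** By [uset_inj] the kernel of [uset] is equality modulo [D], so its image is the ultraproduct up
    to isomorphism, obtained directly as an algebra of sets. *)
Definition ultraproduct : CA m :=
  sub_algebra is_uset_add is_uset_mul is_uset_compl is_uset_zero is_uset_one
    is_uset_cyl is_uset_diag.

Lemma ultraproduct_flat : has_n_flat_rep ultraproduct n.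
Proof. exact: set_algebra_flat. Qed.

(** * The theorem of Los *)

Definition uclass (a : useq) : ultraproduct :=
  exist is_uset (uset a) (ex_intro _ a erefl).

Lemma ultraproduct_eqP (x y : ultraproduct) : sval x = sval y -> x = y.
Proof. exact: (@sub_eqP m (full_set_algebra m M) is_uset). Qed.

Lemma uclass_add a b :
  ca_add (uclass a) (uclass b) = uclass (fun r => ca_add (a r) (b r)).
Proof. by apply: ultraproduct_eqP; rewrite [RHS]uset_add. Qed.

Lemma uclass_mul a b :
  ca_mul (uclass a) (uclass b) = uclass (fun r => ca_mul (a r) (b r)).
Proof. by apply: ultraproduct_eqP; rewrite [RHS]uset_mul. Qed.

Lemma uclass_compl a : ca_compl (uclass a) = uclass (fun r => ca_compl (a r)).
Proof. by apply: ultraproduct_eqP; rewrite [RHS]uset_compl. Qed.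

Lemma uclass_zero : ca_zero ultraproduct = uclass (fun r => ca_zero (A r)).
Proof. by apply: ultraproduct_eqP; rewrite [RHS]uset_zero. Qed.

Lemma uclass_one : ca_one ultraproduct = uclass (fun r => ca_one (A r)).
Proof. by apply: ultraproduct_eqP; rewrite [RHS]uset_one. Qed.

Lemma uclass_cyl i a : ca_c i (uclass a) = uclass (fun r => ca_c i (a r)).
Proof. by apply: ultraproduct_eqP; rewrite [RHS]uset_cyl. Qed.

Lemma uclass_diag i j : ca_d ultraproduct i j = uclass (fun r => ca_d (A r) i j).
Proof. by apply: ultraproduct_eqP; rewrite [RHS]uset_diag. Qed.

Lemma uclass_eval (e : nat -> useq) (t : caterm m) :
  term_eval (fun k => uclass (e k)) t =
  uclass (fun r => term_eval (fun k => e k r) t).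
Proof.
elim: t => [k|||t IHt u IHu|t IHt u IHu|t IHt|i t IHt|i j].
- by [].
- exact: uclass_zero.
- exact: uclass_one.
- exact: etrans (congr2 (@ca_add _ _) IHt IHu) (uclass_add _ _).
- exact: etrans (congr2 (@ca_mul _ _) IHt IHu) (uclass_mul _ _).
- exact: etrans (congr1 (@ca_compl _ _) IHt) (uclass_compl _).
- exact: etrans (congr1 (@ca_c _ _ i) IHt) (uclass_cyl _ _).
- exact: uclass_diag.
Qed.

Lemma upd_uclass (e : nat -> useq) k (a : useq) :
  upd (fun k => uclass (e k)) k (uclass a) = (fun j => uclass (upd e k a j)).
Proof. by apply: funext => j; rewrite /upd; case: eqP. Qed.

(** For the quantifier, an element of the algebra lifts to a sequence, and conversely witnesses at
    the stages, with [ca_zero] where there is none, form a sequence. *)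
Lemma Los (f : caform m) (e : nat -> useq) :
  holds (fun k => uclass (e k)) f <-> D (fun r => holds (fun k => e k r) f).
Proof.
elim: f e => [t u|f IH|f IHf g IHg|k f IH] e /=.
- rewrite !uclass_eval -uset_inj; split=> [/(congr1 sval)//|E].
  exact: ultraproduct_eqP.
- by rewrite IH; apply: ufN.
- rewrite IHf IHg; split=> [[]|H]; first exact: ufI.
  by split; apply: ufS DU _ _ _ H => r [].
- split=> [[[X [a XE]]]|H].
    have -> : exist _ X (ex_intro _ a XE) = uclass a by apply: ultraproduct_eqP.
    rewrite upd_uclass IH; apply: ufS DU _ _ _ => r H; exists (a r).
    rewrite (_ : upd _ _ _ = (fun j => upd e k a j r)) //.
    by apply: funext => j; rewrite /upd; case: eqP.
  have H' r : exists x : A r, (exists x, holds (upd (fun k => e k r) k x) f) ->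
      holds (upd (fun k => e k r) k x) f.
    have [[x Hx]|no] := EM (exists x, holds (upd (fun k => e k r) k x) f).
      by exists x.
    by exists (ca_zero (A r)) => /no.
  pose a r := sval (cid (H' r)); exists (uclass a).
  rewrite upd_uclass IH; apply: ufS DU _ _ _ H => r /(svalP (cid (H' r))).
  rewrite (_ : upd (fun k => e k r) k _ = (fun j => upd e k a j r)) //.
  by apply: funext => j; rewrite /upd; case: eqP.
Qed.

End Ultraproduct.

Theorem mainTheorem9 (m n : nat) :
  2 < m -> m + 2 <= n ->
  ~ exists (k : nat) (Sigma : 'I_k -> caform m),
      (forall i, is_sentence (Sigma i)) /\
      forall A : CA m, has_n_square_rep A n ->
        (has_n_flat_rep A n <-> forall i, models A (Sigma i)).
Proof.
case: m => [|[|[|m']]] // _ le2 [k [Sigma [_ ax]]].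
have le_mn : m'.+3 <= n by rewrite (leq_trans _ le2) // leq_addr.
have [D DU] := nat_ultrafilter_ex.
have [M [msrt [med [mvalid mextend mrealize]]]] :=
  total_model (@uconf_sym _ DU m' n) (@uconf_u0 _ DU m' n) (@uconf_irr _ DU m' n)
    (@uconf_trans _ DU m' n) (@psi_inj _ DU m' n).
pose U := ultraproduct le_mn mvalid mextend.
have Uflat : has_n_flat_rep U n by apply: ultraproduct_flat.
have Umod := (ax U (flat_square Uflat)).1 Uflat.
(* Each stage has a square but no flat representation, so it refutes some axiom. *)
have fails r : exists (i : 'I_k) (e : nat -> stage le_mn r), ~ holds e (Sigma i).
  apply: contrapT => no; apply: (@stage_not_flat m' n le_mn r le2).
  apply: (ax _ (stage_square le_mn r)).2 => i e; apply: contrapT => ne.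
  by apply: no; exists i, e.
(* As [Sigma] is finite, one axiom fails on a set of stages in [D]; the refuting assignments, chosen
   arbitrarily elsewhere, combine into one for [U]. *)
have [i iP] := uf_exists DU (ufT DU fails).
have H r : exists e : nat -> stage le_mn r,
    (exists e : nat -> stage le_mn r, ~ holds e (Sigma i)) -> ~ holds e (Sigma i).
  have [[e ne]|no] := EM (exists e : nat -> stage le_mn r, ~ holds e (Sigma i)).
    by exists e.
  by exists (fun _ => ca_zero _) => /no.
pose e (j r : nat) := sval (cid (H r)) j.
have /(Los mvalid mextend mrealize) He :=
  Umod i (fun j => uclass mvalid mextend (e j)).
have [r [Hr [e' ne']]] := uf_ex DU (ufI DU He iP).
exact: (svalP (cid (H r)) (ex_intro _ e' ne') Hr).
Qed.
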